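(* Let $r\ge 6$ and $n\ge 5r+18$ be integers. Then $$\sigma\big(K_{r+1}-(K_3\cup P_3),\,n\big)=\begin{cases}(r-1)(2n-r)-3(n-r)-1, & \text{if } n-r \text{ is odd},\\ (r-1)(2n-r)-3(n-r), & \text{if } n-r \text{ is even}.\end{cases}$$
   Context: A sequence $\pi=(d_1,\dots,d_n)$ of non-increasing nonnegative integers is graphic if it is the degree sequence of a simple graph on $n$ vertices (a realization of $\pi$); write $\sigma(\pi)=d_1+\dots+d_n$. For a graph $H$, $\pi$ is potentially $H$-graphic if some realization of $\pi$ contains $H$ as a (not necessarily induced) subgraph. $\sigma(H,n)$ denotes the smallest even integer $l$ such that every $n$-term graphic sequence $\pi$ with $\sigma(\pi)\ge l$ is potentially $H$-graphic. For a graph $H$ that is a subgraph of $K_m$, $K_m-H$ is the graph obtained from $K_m$ by deleting the edges of $H$. $K_3$ is the triangle, $P_3$ denotes the path with $3$ edges (on $4$ vertices), and $K_3\cup P_3$ is their disjoint union (7 vertices, 6 edges). *)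

(* Defs.v *)
From mathcomp Require Import all_boot.
Set Implicit Arguments. Unset Strict Implicit. Unset Printing Implicit Defensive.

Definition simple_graph (n : nat) (g : rel 'I_n) : Prop :=
  symmetric g /\ irreflexive g.

Definition deg (n : nat) (g : rel 'I_n) (i : 'I_n) : nat := #|[set j | g i j]|.

Definition seq_sum (pi : seq nat) : nat := sumn pi.

Definition realization (n : nat) (g : rel 'I_n) (pi : seq nat) : Prop :=
  simple_graph g /\ size pi = n /\ forall i : 'I_n, deg g i = nth 0 pi i.

Definition graphic (n : nat) (pi : seq nat) : Prop :=
  sorted geq pi /\ size pi = n /\ exists g : rel 'I_n, realization g pi.

Definition contains_subgraph (n m : nat) (g : rel 'I_n) (H : rel 'I_m) : Prop :=
  exists f : 'I_m -> 'I_n, injective f /\ forall i j, H i j -> g (f i) (f j).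

Definition potentially_graphic (m : nat) (H : rel 'I_m) (n : nat) (pi : seq nat)
  : Prop :=
  exists g : rel 'I_n, realization g pi /\ contains_subgraph g H.

Definition sigma_prop (m : nat) (H : rel 'I_m) (n l : nat) : Prop :=
  forall pi : seq nat, graphic n pi -> l <= seq_sum pi -> potentially_graphic H n pi.

Definition is_sigma (m : nat) (H : rel 'I_m) (n v : nat) : Prop :=
  ~~ odd v /\ sigma_prop H n v /\
  forall l : nat, ~~ odd l -> sigma_prop H n l -> v <= l.

(* The edges of K_3 \cup P_3 placed on vertices 0,1,2 (triangle) and
   3-4-5-6 (path with 3 edges). *)
Definition K3P3_edge (a b : nat) : bool :=
  (minn a b, maxn a b) \in [:: (0,1); (0,2); (1,2); (3,4); (4,5); (5,6)].

(* K_{r+1} - (K_3 \cup P_3), on vertex set 'I_(r+1) (requires r+1 >= 7). *)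
Definition Kr1_minus_K3P3 (r : nat) : rel 'I_(r.+1) :=
  fun i j => (i != j) && ~~ K3P3_edge i j.
Arguments Kr1_minus_K3P3 r : clear implicits.

(* Main.v *)
(* Lower bound: in every realization of the extremal sequence, r - 3 vertices are adjacent
   to all others and the remaining ones span a perfect matching, or a path with two edges
   and a perfect matching. Four of the latter span at most two edges, while any four
   vertices of K_{r+1} - (K_3 u P_3) span at least three.

   Upper bound: induction on r. If r + 1 vertices have degree at least r, remove a vertex
   v of maximum degree: the degree sum of the rest is still large enough for r - 1, and
   the pattern T found there can be moved to vertices of largest degree. Take a
   realization in which v has as many neighbours in T as possible. If v misses some z in
   T, then no exchange on two or three edges gains the edge vz, so every edge outside
   C = T + v touches a small set around an outer neighbour of v; this bounds the degree
   sum, or else yields a clique on r + 1 vertices.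
   If at most r vertices have degree at least r, let C consist of the r + 1 largest
   degrees and maximize the number of edges inside C. The same exchanges show that of two
   nonadjacent vertices of C one has no neighbour outside C. A second exchange and the
   degree sum leave at most three nonadjacent pairs in C, and three pairs at a common
   vertex can be switched into a path. *)
Require Import Defs.
From mathcomp Require Import all_boot zify perm.
From Stdlib Require Import Classical.
Set Implicit Arguments. Unset Strict Implicit. Unset Printing Implicit Defensive.

(** * Degrees in finite graphs *)

Lemma card_sum_mem (T : finType) (A : {set T}) : #|A| = \sum_x (x \in A : nat).
Proof. by rewrite -sum1_card big_mkcond; apply: eq_bigr => x _; case: (x \in A). Qed.

Section Graphs.
Variable V : finType.
Implicit Types (G : rel V) (A B C U : {set V}).

Definition sgraph G := symmetric G /\ irreflexive G.
Definition nbr G x := [set y | G x y].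
Definition degree G x := #|nbr G x|.
Definition outer G C x := nbr G x :\: C.
Definition arcs G A B := [set e : V * V | [&& e.1 \in A, e.2 \in B & G e.1 e.2]].
Definition clique G C := {in C &, forall x y, x != y -> G x y}.
Definition supported G U := forall x y, G x y -> x \in U.

Lemma in_nbr G x y : (y \in nbr G x) = G x y.
Proof. by rewrite inE. Qed.

Lemma in_outer G C x y : (y \in outer G C x) = (y \notin C) && G x y.
Proof. by rewrite !inE. Qed.

Lemma adj_neq G x y : sgraph G -> G x y -> x != y.
Proof. by move=> [_ irr] gxy; apply/eqP => E; rewrite E irr in gxy. Qed.

Lemma degree_gt0P G x : reflect (exists y, G x y) (0 < degree G x).
Proof.
by apply: (iffP card_gt0P) => -[y]; rewrite ?inE => gxy; exists y; rewrite ?inE.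
Qed.

Lemma supported_degree G U x : supported G U -> 0 < degree G x -> x \in U.
Proof. by move=> inU /degree_gt0P [y]; apply: inU. Qed.

Lemma degree_notin G U x : supported G U -> x \notin U -> degree G x = 0.
Proof.
by move=> inU; apply: contraNeq; rewrite -lt0n; apply: supported_degree.
Qed.

Lemma nbr_notin G U x : supported G U -> x \notin U -> nbr G x = set0.
Proof. by move=> inU /(degree_notin inU)/cards0_eq. Qed.

Lemma degree_split G C x : degree G x = #|nbr G x :&: C| + #|outer G C x|.
Proof. by rewrite /degree -(cardsID C (nbr G x)). Qed.

Lemma card_nbrI_sum G A x : #|nbr G x :&: A| = \sum_(y in A) (G x y : nat).
Proof.
rewrite card_sum_mem [RHS]big_mkcond; apply: eq_bigr => y _.
by rewrite !inE andbC; case: (y \in A).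
Qed.

Lemma degree_sum G x : degree G x = \sum_y (G x y : nat).
Proof. by rewrite /degree -[nbr G x]setIT card_nbrI_sum; apply: eq_bigl => y; rewrite inE. Qed.

Lemma card_arcs G A B : #|arcs G A B| = \sum_(x in A) #|nbr G x :&: B|.
Proof.
under eq_bigr do rewrite -sum1_card; rewrite pair_big_dep /= sum1dep_card.
by apply: eq_card => -[x y]; rewrite !inE /= (andbC (G x y)).
Qed.

Lemma card_arcsC G A B : symmetric G -> #|arcs G A B| = #|arcs G B A|.
Proof.
move=> sym; have swap_inj : injective (fun e : V * V => (e.2, e.1)).
  by move=> [x y] [x' y'] [-> ->].
rewrite -(card_imset (mem (arcs G A B)) swap_inj); apply: eq_card => -[x y].
apply/imsetP/idP => [[[x' y']]|]; rewrite !inE /=.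
  by move=> + [-> ->] => /and3P[-> ->]; rewrite sym.
by move=> /and3P[xB yA gxy]; exists (y, x); rewrite // inE /= yA xB sym.
Qed.

Lemma sum_degree_arcs G : \sum_x degree G x = #|arcs G setT setT|.
Proof. by rewrite card_arcs; apply: eq_big => x; rewrite ?inE ?setIT. Qed.

Lemma sum_degree_split G A : symmetric G -> \sum_x degree G x =
  \sum_(x in A) #|nbr G x :&: A| + \sum_(x in ~: A) (#|nbr G x :&: A| + degree G x).
Proof.
move=> sym; rewrite (bigID (mem A)) /= big_split /= addnA.
rewrite (eq_bigl (mem (~: A)) _ (fun x => esym (in_setC x A))); congr (_ + _).
under eq_bigr do rewrite (degree_split G A); rewrite big_split /=; congr (_ + _).
under eq_bigr do rewrite /outer setDE.
by rewrite -card_arcs card_arcsC // card_arcs.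
Qed.

Lemma card_nbrI_lt G C x : irreflexive G -> x \in C -> #|nbr G x :&: C| < #|C|.
Proof.
move=> irr xC; apply: proper_card; apply/properP; split; first exact: subsetIr.
by exists x; rewrite // !inE irr.
Qed.

Lemma card_nbrI_nonadj G C x y : irreflexive G -> x \in C -> y \in C -> x != y ->
  ~~ G x y -> #|nbr G x :&: C| + 2 <= #|C|.
Proof.
move=> irr xC yC nxy ngxy; rewrite addn2 (cardsD1 y C) yC add1n ltnS.
have -> : nbr G x :&: C = nbr G x :&: (C :\ y).
  by apply/setP => z; rewrite !inE; case: (eqVneq z y) => [->|] //=; rewrite (negbTE ngxy).
by apply: card_nbrI_lt; rewrite // !inE nxy.
Qed.

End Graphs.

(** * Degree-preserving exchanges *)

Section Exchanges.
Variable V : finType.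
Implicit Types (G : rel V) (C : {set V}).

Definition rewiring G G' := sgraph G' /\ degree G' =1 degree G.

Lemma rewiring_trans G1 G2 G3 : rewiring G1 G2 -> rewiring G2 G3 -> rewiring G1 G3.
Proof. by move=> [_ d12] [s3 d23]; split=> // x; rewrite d23. Qed.

Lemma rewiring_sum_degree G G' : rewiring G G' ->
  \sum_x degree G' x = \sum_x degree G x.
Proof. by move=> [_ d]; apply: eq_bigr. Qed.

Lemma rewiring_supported G G' U : rewiring G G' -> supported G U -> supported G' U.
Proof.
move=> [_ d] inU x y gxy; apply: (supported_degree inU).
by rewrite -d; apply/degree_gt0P; exists y.
Qed.

Definition same_pair (a b x y : V) :=
  (x == a) && (y == b) || (x == b) && (y == a).

Lemma same_pairC a b x y : same_pair a b x y = same_pair a b y x.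
Proof. by rewrite /same_pair orbC (andbC (y == a)) (andbC (y == b)). Qed.

Lemma same_pair_rev a b x y : same_pair a b x y = same_pair b a x y.
Proof. exact: orbC. Qed.

Lemma same_pairxx a b x : a != b -> same_pair a b x x = false.
Proof.
rewrite /same_pair andbC orbb; case: (eqVneq x b) => //= ->.
by rewrite eq_sym => /negbTE.
Qed.

Lemma same_pairP a b x y :
  reflect ((x = a /\ y = b) \/ (x = b /\ y = a)) (same_pair a b x y).
Proof.
apply: (iffP orP) => -[].
- by move=> /andP[/eqP-> /eqP->]; left.
- by move=> /andP[/eqP-> /eqP->]; right.
- by move=> [-> ->]; left; rewrite !eqxx.
- by move=> [-> ->]; right; rewrite !eqxx.
Qed.

Lemma same_pair_notin C a b x y : a \notin C \/ b \notin C -> x \in C -> y \in C ->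
  ~~ same_pair a b x y.
Proof.
move=> out xC yC; apply/negP => /same_pairP [[xE yE]|[xE yE]]; subst x y;
  by case: out; rewrite ?xC ?yC.
Qed.

(* Replaces the edges [a b] and [c d] by [a d] and [c b]. *)
Definition switch G a b c d : rel V := fun x y =>
  [|| same_pair a d x y, same_pair c b x y |
      [&& G x y, ~~ same_pair a b x y & ~~ same_pair c d x y]].

Lemma switch_ad G a b c d : switch G a b c d a d.
Proof. by rewrite /switch /same_pair !eqxx. Qed.

Lemma switch_cb G a b c d : switch G a b c d c b.
Proof. by rewrite /switch /same_pair !eqxx orbT. Qed.

Lemma switch_keep G a b c d x y : G x y -> ~~ same_pair a b x y -> ~~ same_pair c d x y ->
  switch G a b c d x y.
Proof. by rewrite /switch => -> -> ->; rewrite !orbT. Qed.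

Lemma switch_keep_in G a b c d C :
  a \notin C \/ b \notin C -> c \notin C \/ d \notin C ->
  {in C &, subrel G (switch G a b c d)}.
Proof.
by move=> ab cd x y xC yC g; apply: switch_keep; rewrite ?(@same_pair_notin C).
Qed.

Lemma switchC G a b c d : switch G c d a b =2 switch G a b c d.
Proof. by move=> x y; rewrite /switch orbCA; congr [|| _, _ | _ && _]; apply: andbC. Qed.

Lemma switch_rev G a b c d : switch G b a d c =2 switch G a b c d.
Proof.
move=> x y; rewrite /switch orbCA (same_pair_rev d a) (same_pair_rev b c).
by rewrite (same_pair_rev b a) (same_pair_rev d c).
Qed.

Lemma degree_switch G a b c d : sgraph G -> G a b -> G c d -> a != d -> c != b ->
  ~~ G a d -> ~~ G c b -> degree (switch G a b c d) a = degree G a.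
Proof.
move=> sG gab gcd nad ncb ngad ngcb; have nab := adj_neq sG gab.
have nac : a != c by apply: contraNneq ngcb => <-.
have nbd : b != d by apply: contraNneq ngad => <-.
have -> : degree (switch G a b c d) a = #|d |: (nbr G a :\ b)|.
  apply: eq_card => y; rewrite !inE /switch /same_pair eqxx.
  rewrite (negbTE nab) (negbTE nac) (negbTE nad) /= !orbF !andbT.
  by rewrite andbC.
by rewrite cardsU1 !inE (negbTE ngad) andbF /degree (cardsD1 b (nbr G a)) inE gab.
Qed.

Lemma switch_rewiring G a b c d : sgraph G -> G a b -> G c d -> a != d -> c != b ->
  ~~ G a d -> ~~ G c b -> rewiring G (switch G a b c d).
Proof.
move=> sG gab gcd nad ncb ngad ngcb; have [sym irr] := sG.
have nab := adj_neq sG gab; have ncd := adj_neq sG gcd.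
have [gba gdc] : G b a /\ G d c by rewrite !(sym _ a) !(sym _ c).
have [ngda ngbc] : ~~ G d a /\ ~~ G b c by rewrite !(sym _ a) !(sym _ c).
split; first split=> [x y|x].
- by rewrite /switch !(same_pairC _ _ y) sym.
- by rewrite /switch irr !same_pairxx.
have eq_degree G1 G2 : G1 =2 G2 -> degree G1 =1 degree G2.
  by move=> E x; apply: eq_card => y; rewrite !inE E.
move=> x; have [->|nxa] := eqVneq x a; first exact: degree_switch.
have [->|nxc] := eqVneq x c.
  by rewrite -(eq_degree _ _ (switchC G a b c d)) degree_switch.
have [->|nxb] := eqVneq x b.
  by rewrite -(eq_degree _ _ (switch_rev G a b c d)) degree_switch // eq_sym.
have [->|nxd] := eqVneq x d.
  rewrite -(eq_degree _ _ (switchC G a b c d)) -(eq_degree _ _ (switch_rev G c d a b)).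
  by rewrite degree_switch // eq_sym.
apply: eq_card => y; rewrite !inE /switch /same_pair.
by rewrite (negbTE nxa) (negbTE nxb) (negbTE nxc) (negbTE nxd) /= andbT.
Qed.

Definition addable G C u v :=
  exists G', [/\ rewiring G G', {in C &, subrel G G'} & G' u v].

Lemma addable_adj G C u v : sgraph G -> G u v -> addable G C u v.
Proof. by move=> sG guv; exists G; split=> //; split. Qed.

Lemma addable_trans G G' C u v : rewiring G G' -> {in C &, subrel G G'} ->
  addable G' C u v -> addable G C u v.
Proof.
move=> rG sub [G'' [rG' sub' guv]]; exists G''; split=> //; first exact: rewiring_trans rG'.
by move=> x y xC yC gxy; apply/sub'/sub.
Qed.

Lemma addable_sym G C u v : addable G C u v -> addable G C v u.
Proof. by move=> [G' [[[sym irr] d] sub guv]]; exists G'; split=> //; rewrite sym. Qed.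

Lemma addable_exchange2 G C u v w b : sgraph G -> u != v -> ~~ G u v ->
  w \in outer G C u -> b \in outer G C v -> w != b -> ~~ G w b -> addable G C u v.
Proof.
move=> [sym irr] nuv nguv; rewrite !in_outer => /andP[wC guw] /andP[bC gvb] nwb ngwb.
exists (switch G u w b v); split; last exact: switch_ad.
  by apply: switch_rewiring; rewrite ?(sym b) 1?(eq_sym b).
by apply: switch_keep_in; [right|left].
Qed.

(* The first of the two switches gives [v] the outer neighbour [x], not adjacent to [w]. *)
Lemma addable_exchange3_out G C u v w b x y : sgraph G -> u \in C -> v \in C ->
  u != v -> ~~ G u v -> w \in outer G C u -> b \in outer G C v ->
  G x y -> x \notin C -> x != w -> ~~ G w x -> y != b -> ~~ G b y -> addable G C u v.
Proof.
move=> sG uC vC nuv nguv wu bv gxy xC nxw ngwx nyb ngby; have [sym _] := sG.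
have [gvx|ngvx] := boolP (G v x).
  apply: (@addable_exchange2 _ _ _ _ w x) => //; last by rewrite eq_sym.
  by rewrite in_outer xC.
have [[wC guw] [bC gvb]] : (w \notin C /\ G u w) /\ (b \notin C /\ G v b).
  by move: wu bv; rewrite !in_outer => /andP[-> ->] /andP[-> ->].
have outC t o : t \in C -> o \notin C -> t != o by move=> tC; apply: contraNneq => <-.
have [nvx nvw] := (outC v x vC xC, outC v w vC wC).
have [nux nub] := (outC u x uC xC, outC u b uC bC).
have nwx : w != x by rewrite eq_sym.
have rG : rewiring G (switch G v b y x).
  by apply: switch_rewiring; rewrite // sym.
have sub : {in C &, subrel G (switch G v b y x)} by apply: switch_keep_in; right.
apply: (addable_trans rG sub).
have [guv|nguv'] := boolP (switch G v b y x u v).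
  by apply: addable_adj => //; case: rG.
apply: (@addable_exchange2 _ _ _ _ w x) => //; first by case: rG.
- rewrite in_outer wC; apply: switch_keep => //; rewrite /same_pair.
    by rewrite (negbTE nuv) (negbTE nub).
  by rewrite (negbTE nux) (negbTE nwx) andbF.
- by rewrite in_outer xC switch_ad.
have nxb : x != b by apply: contraNneq ngby => <-.
rewrite /switch (negbTE ngwx) orbF /same_pair (eq_sym w) (negbTE nvw) (negbTE nwx).
by rewrite (negbTE nxb) (negbTE (adj_neq sG gxy)) !andbF.
Qed.

Lemma addable_exchange3 G C u v w b x y : sgraph G -> u \in C -> v \in C ->
  u != v -> ~~ G u v -> w \in outer G C u -> b \in outer G C v ->
  G x y -> x \notin C \/ y \notin C -> x != w -> ~~ G w x -> y != b -> ~~ G b y ->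
  addable G C u v.
Proof.
move=> sG uC vC nuv nguv wu bv gxy [xC|yC] nxw ngwx nyb ngby.
  exact: (@addable_exchange3_out _ _ _ _ w b x y).
have [sym _] := sG; apply: addable_sym.
by apply: (@addable_exchange3_out _ _ _ _ b w y x) => //; rewrite 1?eq_sym // sym.
Qed.

End Exchanges.

(** * Extremal choices *)

Lemma exists_maximizer (T : Type) (P : T -> Prop) (f : T -> nat) (B : nat) :
  (exists t, P t) -> (forall t, P t -> f t <= B) ->
  exists2 t, P t & forall t', P t' -> f t' <= f t.
Proof.
move=> [t0 Pt0] ub; have [k] := ubnP (B - f t0).
elim: k t0 Pt0 => // k IH t0 Pt0 lek.
have [[t1 [Pt1 lt01]]|no] := classic (exists t1, P t1 /\ f t0 < f t1).
  by apply: (IH t1) => //; have := ub _ Pt1; lia.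
by exists t0 => // t Pt; rewrite leqNgt; apply/negP => lt; apply: no; exists t.
Qed.

Section FiniteSets.
Variables (T : finType).
Implicit Types A B C U : {set T}.

Lemma exists_subset_card A k : k <= #|A| -> exists2 B : {set T}, B \subset A & #|B| = k.
Proof.
move=> /card_geqP [s [us sz sA]]; exists [set x in s].
  by apply/subsetP => x; rewrite inE; apply: sA.
by rewrite cardsE (card_uniqP us).
Qed.

Lemma exists_top_subset U (f : T -> nat) k : k <= #|U| -> exists C : {set T},
  [/\ C \subset U, #|C| = k & {in C & U :\: C, forall c o, f o <= f c}].
Proof.
elim: k => [_|k IH lt].
  by exists set0; split; rewrite ?sub0set ?cards0 // => c o; rewrite inE.
have [C [CU Ck top]] := IH (ltnW lt).
have /card_gt0P [m0 m0D] : 0 < #|U :\: C| by rewrite cardsD (setIidPr CU) Ck; lia.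
have [m mD mmax] := @arg_maxnP _ m0 (mem (U :\: C)) f m0D.
have [mU mC] := setDP mD; exists (m |: C); split.
- by rewrite subUset sub1set mU.
- by rewrite cardsU1 mC Ck.
move=> c o; rewrite setDUr in_setU1 => cmC /setIP[_ oD].
by case/predU1P: cmC => [->|cC]; [apply: mmax | apply: top].
Qed.

Lemma injection_extend (V : finType) (D : {set T}) (C : {set V}) (f : T -> V) :
  {in D &, injective f} -> {in D, forall x, f x \in C} -> #|T| <= #|C| ->
  exists g : T -> V, [/\ injective g, forall x, g x \in C & {in D, g =1 f}].
Proof.
move=> + + leTC; have [k] := ubnP #|~: D|; elim: k D f => // k IH D f ltk inj fC.
have [DT|/set0Pn [x]] := eqVneq (~: D) set0.
  have inD x : x \in D by have := in_set0 x; rewrite -DT inE => /negbFE.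
  by exists f; split=> // [x y|x]; [apply: inj | apply: fC].
rewrite inE => xD.
have fDC : f @: D \subset C by apply/subsetP => _ /imsetP [y yD ->]; apply: fC.
have /card_gt0P [c] : 0 < #|C :\: f @: D|.
  rewrite cardsD (setIidPr fDC) card_in_imset // subn_gt0 (leq_trans _ leTC) //.
  by rewrite -cardsT; apply: proper_card; rewrite properT; apply: contraNneq xD => ->.
rewrite inE => /andP[cD cC]; pose f' y := if y == x then c else f y.
have f'D : {in D, f' =1 f}.
  by move=> y yD; rewrite /f'; case: eqP => // yx; rewrite -yx yD in xD.
have ncf y : y \in D -> c != f y by move=> yD; apply: contraNneq cD => ->; apply: imset_f.
have f'x : f' x = c by rewrite /f' eqxx.
have [||| g [ginj gC gf]] := IH (x |: D) f'.
- by rewrite setCU setIC -setDE; have := cardsD1 x (~: D); rewrite inE xD; lia.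
- move=> y z; rewrite !in_setU1 => /predU1P[->|yD] /predU1P[->|zD] //.
  + by rewrite f'x f'D // => /eqP; rewrite (negbTE (ncf z zD)).
  + by rewrite f'x f'D // => /esym/eqP; rewrite (negbTE (ncf y yD)).
  + by rewrite !f'D //; apply: inj.
- by move=> y /setU1P [->|yD]; [rewrite f'x | rewrite f'D // fC].
by exists g; split=> // y yD; rewrite gf ?f'D // in_setU1 yD orbT.
Qed.

End FiniteSets.

(** * Graphs whose complement embeds in [K_3 u P_3] *)

Lemma K3P3_edgeC a b : K3P3_edge a b = K3P3_edge b a.
Proof. by rewrite /K3P3_edge minnC maxnC. Qed.

Lemma K3P3_edge_lt7 a b : K3P3_edge a b -> a < 7 /\ b < 7.
Proof. rewrite /K3P3_edge !inE !xpair_eqE; lia. Qed.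

Lemma size_K3P3_nbrs a : size [seq b <- iota 0 7 | K3P3_edge a b] <= 2.
Proof.
have [|a7] := ltnP a 7; first by do 7?[case: a => [|a] //].
rewrite (eq_filter (a2 := pred0)) ?filter_pred0 // => b.
by apply/negP => /K3P3_edge_lt7 [] /leq_trans/(_ a7); rewrite ltnn.
Qed.

Section Embedding.
Variable V : finType.
Implicit Types (G M : rel V) (A B C S T U Z : {set V}).

(* Labels [>= 7] are isolated, hence [V] may have any size. *)
Definition embeds_K3P3 M :=
  exists2 l : V -> nat, injective l & forall x y, M x y -> K3P3_edge (l x) (l y).

Lemma embeds_K3P3_sub M M' : subrel M' M -> embeds_K3P3 M -> embeds_K3P3 M'.
Proof. by move=> sub [l inj lE]; exists l => // x y /sub; apply: lE. Qed.

Lemma embeds_K3P3_degree M x : embeds_K3P3 M -> degree M x <= 2.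
Proof.
move=> [l inj lE]; rewrite /degree cardE -(size_map l).
apply: leq_trans (size_K3P3_nbrs (l x)); apply: uniq_leq_size.
  by rewrite map_inj_uniq ?enum_uniq.
move=> k /mapP[y]; rewrite mem_enum inE => /lE e ->.
by rewrite mem_filter e mem_iota; case: (K3P3_edge_lt7 e).
Qed.

Lemma embeds_K3P3_labels M (s : seq (V * nat)) :
  uniq (unzip1 s) -> uniq (unzip2 s) -> all (gtn 7) (unzip2 s) ->
  (forall x y, M x y -> exists i j, [/\ (x, i) \in s, (y, j) \in s & K3P3_edge i j]) ->
  embeds_K3P3 M.
Proof.
move=> u1 u2 /allP lt7 cover; have sz : size (unzip2 s) = size (unzip1 s) by rewrite !size_map.
pose l x := if x \in unzip1 s then nth 0 (unzip2 s) (index x (unzip1 s)) else 7 + enum_rank x.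
have lE x i : (x, i) \in s -> l x = i.
  move=> /(nthP (x, 0)) [k ks E]; rewrite /l.
  have xE : nth x (unzip1 s) k = x by rewrite (nth_map (x, 0)) // E.
  rewrite -xE mem_nth ?size_map // index_uniq ?size_map //.
  by rewrite (nth_map (x, 0)) // E.
have l_lt7 x : (l x < 7) = (x \in unzip1 s).
  rewrite /l; case: ifP => xs; last by rewrite -[X in _ < X]addn0 ltn_add2l ltn0.
  by apply: lt7; rewrite mem_nth // sz index_mem.
exists l => [x y lxy|x y /cover [i [j [/lE-> /lE->]]] //].
have : (x \in unzip1 s) = (y \in unzip1 s) by rewrite -!l_lt7 lxy.
move: lxy; rewrite /l; case: ifP => xs; case: ifP => ys // + _.
  by move/eqP; rewrite nth_uniq ?sz ?index_mem // => /eqP/index_inj; apply.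
by move/addnI/val_inj/enum_rank_inj.
Qed.

Definition nonadj G C : rel V := fun x y => [&& x \in C, y \in C, x != y & ~~ G x y].

Lemma nonadj_sgraph G C : symmetric G -> sgraph (nonadj G C).
Proof.
move=> sym; split=> [x y|x]; last by rewrite /nonadj eqxx !andbF.
by rewrite /nonadj sym eq_sym; case: (x \in C); case: (y \in C).
Qed.

Lemma nonadj_degree G C x : irreflexive G -> x \in C ->
  #|nbr G x :&: C| + (degree (nonadj G C) x).+1 = #|C|.
Proof.
move=> irr xC; rewrite -(cardsID (nbr G x) C) setIC; congr (_ + _).
rewrite (cardsD1 x (C :\: _)) !inE xC irr add1n; congr _.+1; apply: eq_card => y.
by rewrite !inE /nonadj xC eq_sym; case: (y != x); case: (y \in C); case: (G x y).
Qed.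

Definition K3P3_clique G C := embeds_K3P3 (nonadj G C).

Lemma K3P3_clique_sub G G' C : {in C &, subrel G G'} -> K3P3_clique G C -> K3P3_clique G' C.
Proof.
move=> sub; apply: embeds_K3P3_sub => x y /and4P[xC yC nxy ng].
by rewrite /nonadj xC yC nxy; apply: contra ng; apply: sub.
Qed.

Lemma K3P3_clique_complete G C : clique G C -> K3P3_clique G C.
Proof.
move=> cl; apply: (@embeds_K3P3_labels _ [::]) => // x y /and4P[xC yC nxy].
by rewrite cl.
Qed.

Lemma K3P3_clique_setU1 G T v : symmetric G -> {in T, forall x, G v x} ->
  K3P3_clique G T -> K3P3_clique G (v |: T).
Proof.
move=> sym dom; apply: embeds_K3P3_sub => x y; rewrite /nonadj !in_setU1.
case: (eqVneq x v) => [->|nxv]; case: (eqVneq y v) => [->|nyv] //=; rewrite ?eqxx //.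
- by case: (boolP (y \in T)) => yT; rewrite ?andbF // dom // !andbF.
- by case: (boolP (x \in T)) => xT; rewrite ?andbF // sym dom // !andbF.
Qed.

Definition row_swap G x y Z : rel V := fun p q =>
  if p \in Z then G p (tperm x y q) else if q \in Z then G (tperm x y p) q else G p q.

Lemma row_swap_rewiring G x y Z : sgraph G -> x \notin Z -> y \notin Z ->
  #|nbr G x :&: Z| = #|nbr G y :&: Z| -> rewiring G (row_swap G x y Z).
Proof.
move=> [sym irr] xZ yZ balanced.
have tpZ p : p \in Z -> tperm x y p = p.
  by move=> pZ; rewrite tpermD //; [apply: contraNneq xZ|apply: contraNneq yZ] => ->.
split; first split=> [p q|p].
- by rewrite /row_swap; case: ifP => pZ; case: ifP => qZ //; rewrite ?(tpZ p) ?(tpZ q) // sym.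
- by rewrite /row_swap; case: (boolP (p \in Z)) => pZ; rewrite ?tpZ // irr.
move=> p; have [pZ|pZ] := boolP (p \in Z).
  rewrite /degree -(card_imset (mem (nbr G p)) (@perm_inj _ (tperm x y))).
  apply: eq_card => q; rewrite inE /row_swap pZ; apply/idP/imsetP.
    by move=> g; exists (tperm x y q); rewrite ?tpermK // inE.
  by move=> [q']; rewrite inE => g ->; rewrite tpermK.
have inZ : nbr (row_swap G x y Z) p :&: Z = nbr G (tperm x y p) :&: Z.
  by apply/setP => q; rewrite !inE /row_swap (negbTE pZ); case: (q \in Z); rewrite ?andbF.
have outZ : outer (row_swap G x y Z) Z p = outer G Z p.
  by apply/setP => q; rewrite !inE /row_swap (negbTE pZ); case: (q \in Z).
rewrite (degree_split _ Z) inZ outZ (degree_split G Z p); congr (_ + _).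
by case: tpermP => [->|->|].
Qed.

Lemma exists_balanced_set G x y : sgraph G -> degree G x <= degree G y ->
  exists Z, [/\ x \notin Z, y \notin Z, #|nbr G x :&: Z| = #|nbr G y :&: Z| &
    forall t, t != y -> G x t -> ~~ G y t -> t \in Z].
Proof.
move=> [sym irr] le.
pose X := (nbr G x :\: nbr G y) :\ y; pose Y := (nbr G y :\: nbr G x) :\ x.
have leXY : #|X| <= #|Y|.
  have := cardsD1 x (nbr G y :\: nbr G x); have := cardsD1 y (nbr G x :\: nbr G y).
  rewrite !inE !irr /= (sym y x) -/X -/Y.
  have := cardsID (nbr G y) (nbr G x); have := cardsID (nbr G x) (nbr G y).
  by move: le; rewrite (setIC (nbr G y)) /degree; lia.
have [Y1 sY cY] := exists_subset_card leXY.
have Y1E t : t \in Y1 -> [&& t != x, ~~ G x t & G y t].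
  by move/(subsetP sY); rewrite !inE.
exists (X :|: Y1); split.
- by rewrite !inE irr /= !andbF; apply/negP => /Y1E; rewrite eqxx.
- by rewrite !inE eqxx /=; apply/negP => /Y1E; rewrite irr !andbF.
- have -> : nbr G x :&: (X :|: Y1) = X.
    apply/setP => t; rewrite !inE; case: (boolP (t \in Y1)) => [/Y1E/and3P[_ /negbTE-> _]|_].
      by rewrite !andbF.
    by rewrite orbF; case: (G x t); rewrite ?andbF.
  have -> : nbr G y :&: (X :|: Y1) = Y1.
    apply/setP => t; rewrite !inE; case: (boolP (t \in Y1)) => [/Y1E/and3P[_ _ ->]|_].
      by rewrite orbT.
    by rewrite orbF; case: (G y t); rewrite ?andbF.
  by rewrite cY.
by move=> t nty gxt ngyt; rewrite !inE nty ngyt gxt.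
Qed.

Lemma K3P3_clique_move G T x y : sgraph G -> x \in T -> y \notin T ->
  degree G x <= degree G y -> K3P3_clique G T ->
  exists2 G', rewiring G G' & K3P3_clique G' (y |: T :\ x).
Proof.
move=> sG xT yT le [l inj lE]; have [sym _] := sG.
have [Z [xZ yZ balanced ZE]] := exists_balanced_set sG le.
have rG := row_swap_rewiring sG xZ yZ balanced.
exists (row_swap G x y Z) => //; have [[sym' _] _] := rG.
have tperm_id t : t \in T :\ x -> tperm x y t = t.
  by rewrite !inE => /andP[tx tT]; rewrite tpermD // eq_sym //; apply: contraNneq yT => <-.
have tperm_in t : t \in y |: T :\ x -> tperm x y t \in T.
  by move=> /setU1P [->|tT]; rewrite ?tpermR // tperm_id //; case/setD1P: tT.
have old p q : p \in T :\ x -> q \in T :\ x -> row_swap G x y Z p q = G p q.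
  by move=> pT qT; rewrite /row_swap !tperm_id // if_same; case: ifP.
have new t : t \in T :\ x -> G x t -> row_swap G x y Z y t.
  rewrite /row_swap (negbTE yZ) tpermR => /setD1P [_ tT] gxt; case: ifP => // /negbT tZ.
  by apply: contraR tZ; apply: ZE => //; apply: contraNneq yT => <-.
exists (fun t => l (tperm x y t)) => [p q /inj/perm_inj //|p q].
rewrite /nonadj => /and4P[pT qT npq ng]; apply: lE.
rewrite /nonadj !tperm_in // (inj_eq perm_inj) npq /=; apply: contra ng.
case/setU1P: pT npq => [->|pT]; case/setU1P: qT => [->|qT]; rewrite ?eqxx // => _.
- by rewrite tpermR tperm_id //; apply: new.
- by rewrite tpermR tperm_id // sym sym'; apply: new.
- by rewrite !tperm_id // old.
Qed.

End Embedding.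

(** * Configurations without exchange *)

Section EdgeCover.
Variable V : finType.
Implicit Types (G : rel V) (A C K P U Y : {set V}).

Lemma degree_nonadj_le G C x y : irreflexive G -> x \in C -> y \in C -> x != y ->
  ~~ G x y -> degree G x + 2 <= #|outer G C x| + #|C|.
Proof.
move=> irr xC yC nxy ngxy; rewrite (degree_split G C x).
by have := card_nbrI_nonadj irr xC yC nxy ngxy; lia.
Qed.

Lemma card_arcs_nonadj G C u z : sgraph G -> u \in C -> z \in C -> u != z -> ~~ G u z ->
  #|arcs G C C| + 2 <= #|C| * (#|C| - 1).
Proof.
move=> [sym irr] uC zC nuz nguz; rewrite card_arcs (big_setD1 u) //= (big_setD1 z) /=; last first.
  by rewrite !inE eq_sym nuz.
have uC2 := card_nbrI_nonadj irr uC zC nuz nguz.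
have zC2 : #|nbr G z :&: C| + 2 <= #|C|.
  by apply: (@card_nbrI_nonadj _ _ _ z u); rewrite // 1?eq_sym // sym.
have rest : \sum_(i in C :\ u :\ z) #|nbr G i :&: C| <= #|C :\ u :\ z| * (#|C| - 1).
  rewrite -sum_nat_const; apply: leq_sum => i /setD1P[_ /setD1P[_ iC]].
  by have := card_nbrI_lt irr iC; lia.
have := cardsD1 u C; have := cardsD1 z (C :\ u).
by rewrite !inE eq_sym nuz zC uC /= => cz cu; nia.
Qed.

Lemma sum_degree_cover G C P Y : symmetric G ->
  (forall x y, G x y -> x \notin C -> [|| x \in Y, y \in Y | y \in P]) ->
  \sum_x degree G x <= #|arcs G C C| +
    2 * (\sum_(y in Y) degree G y + \sum_(p in P) #|outer G C p|).
Proof.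
move=> sym cover; rewrite sum_degree_arcs.
have -> : \sum_(y in Y) degree G y = #|arcs G Y setT|.
  by rewrite card_arcs; under [RHS]eq_bigr do rewrite setIT.
have -> : \sum_(p in P) #|outer G C p| = #|arcs G P (~: C)|.
  by rewrite card_arcs; under [RHS]eq_bigr do rewrite -setDE.
have sub : arcs G setT setT \subset arcs G C C :|:
    ((arcs G Y setT :|: arcs G setT Y) :|: (arcs G P (~: C) :|: arcs G (~: C) P)).
  apply/subsetP => -[x y]; rewrite !inE /= => gxy; rewrite gxy !andbT.
  case: (boolP (x \in C)) => xC; case: (boolP (y \in C)) => yC; rewrite /= ?andbT //.
  - have gyx : G y x by rewrite sym.
    by case/or3P: (cover y x gyx yC) => ->; rewrite ?orbT.
  - by case/or3P: (cover x y gxy xC) => ->; rewrite ?orbT.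
  - by case/or3P: (cover x y gxy xC) => h; rewrite h ?orbT.
have cardU (A B : {set V * V}) : #|A :|: B| <= #|A| + #|B| := (leq_card_setU A B).1.
apply: leq_trans (subset_leq_card sub) _; apply: leq_trans (cardU _ _) _.
rewrite leq_add2l mulnDr !mul2n -!addnn.
apply: leq_trans (cardU _ _) _; apply: leq_add; apply: leq_trans (cardU _ _) _.
  by rewrite (card_arcsC setT).
by rewrite (card_arcsC (~: C)).
Qed.

Lemma edge_cover_bound G C P Y u z r D : sgraph G -> u \in C -> z \in C -> u != z ->
  ~~ G u z -> #|C| = r.+1 -> P \subset C :\ u :\ z ->
  (forall x y, G x y -> x \notin C -> [|| x \in Y, y \in Y | y \in P]) ->
  {in Y, forall y, degree G y <= D} -> {in P, forall c, #|outer G C c| <= D.+1} ->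
  #|Y| + #|P| <= D ->
  \sum_x degree G x + 4 <= r * r + 3 * r + 2 * (D * D).
Proof.
move=> sG uC zC nuz nguz cC PC cover degY outP szD; have [sym _] := sG.
have := sum_degree_cover sym cover; have := card_arcs_nonadj sG uC zC nuz nguz.
have cP : #|P| < r.
  have := subset_leq_card PC; have := cardsD1 u C; have := cardsD1 z (C :\ u).
  by rewrite !inE eq_sym nuz zC uC cC /=; lia.
have bY : \sum_(y in Y) degree G y <= #|Y| * D by rewrite -sum_nat_const; apply: leq_sum.
have bP : \sum_(p in P) #|outer G C p| <= #|P| * D.+1.
  by rewrite -sum_nat_const; apply: leq_sum.
have bYP : #|Y| * D + #|P| * D.+1 <= D * D + (r - 1) by nia.
by rewrite cC; lia.
Qed.

Lemma clique_of_nbrs G A v r : symmetric G -> A \subset nbr G v -> v \notin A -> clique G A ->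
  r <= #|A| -> exists2 K : {set V}, #|K| = r.+1 & clique G K.
Proof.
move=> sym dom vA cl /exists_subset_card [B sB cB]; exists (v |: B).
  by rewrite cardsU1 cB (contra (subsetP sB v)).
have domB b : b \in B -> G v b by move=> /(subsetP sB)/(subsetP dom); rewrite inE.
move=> x y /setU1P[->|xB] /setU1P[->|yB]; rewrite ?eqxx // => nxy.
- exact: domB.
- by rewrite sym domB.
- by apply: cl; rewrite ?(subsetP sB).
Qed.

Lemma clique_subset_supported G U K : supported G U -> clique G K -> 1 < #|K| -> K \subset U.
Proof.
move=> inU cl K1; apply/subsetP => x xK.
have /card_gt0P [y] : 0 < #|K :\ x| by have := cardsD1 x K; rewrite xK; lia.
by rewrite !inE => /andP[nyx yK]; apply: (inU x y); apply: cl; rewrite // eq_sym.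
Qed.

End EdgeCover.

Section Stuck.
Variable V : finType.
Implicit Types (G : rel V) (A C K P U Y : {set V}).

Definition closed_outer G C w := (w |: nbr G w) :\: C.

Lemma in_closed_outer G C w x : (x \in closed_outer G C w) = (x \notin C) && ((x == w) || G w x).
Proof. by rewrite !inE. Qed.

Lemma card_closed_outer G C w : irreflexive G -> w \notin C ->
  #|closed_outer G C w| = #|outer G C w|.+1.
Proof.
by move=> irr wC; rewrite /closed_outer setDUl (setDidPl _) ?disjoints1 // cardsU1 !inE irr andbF.
Qed.

Section Pair.
Variables (G : rel V) (C : {set V}) (u z : V).
Hypotheses (sG : sgraph G) (uC : u \in C) (zC : z \in C) (nuz : u != z).
Hypothesis stuck : ~ addable G C u z.

Let sym : symmetric G. Proof. by case: sG. Qed.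
Let irr : irreflexive G. Proof. by case: sG. Qed.

Lemma stuck_nonadj : ~~ G u z.
Proof. by apply/negP => g; apply/stuck/addable_adj. Qed.

Lemma stuck_adj w b : w \in outer G C u -> b \in outer G C z -> w != b -> G w b.
Proof.
move=> wu bz nwb; apply/negPn/negP => ngwb.
exact/stuck/(addable_exchange2 sG nuz stuck_nonadj wu bz nwb).
Qed.

Lemma stuck_edge w b x y : w \in outer G C u -> b \in outer G C z ->
  G x y -> x \notin C \/ y \notin C -> [|| x == w, G w x, y == b | G b y].
Proof.
move=> wu bz gxy xyC; apply/negPn/negP; rewrite !negb_or => /and4P[nxw ngwx nyb ngby].
exact/stuck/(addable_exchange3 sG uC zC nuz stuck_nonadj wu bz gxy xyC).
Qed.

Lemma stuck_outer_clique : clique G (outer G C u) \/ clique G (outer G C z).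
Proof.
have [cl|ncl] := classic (clique G (outer G C u)); [by left | right].
move=> b1 b2 b1z b2z nb12; apply/negPn/negP => ngb; apply: ncl => w1 w2 w1u w2u nw12.
apply/negPn/negP => ngw.
have nw2b2 : w2 != b2 by apply: contraNneq ngw => E; apply: stuck_adj => //; rewrite E.
have w2C : w2 \notin C by move: w2u; rewrite in_outer => /andP[].
have := stuck_edge w1u b1z (stuck_adj w2u b2z nw2b2) (or_introl w2C).
by rewrite (negbTE ngw) (negbTE ngb) !(eq_sym _ w1) !(eq_sym _ b1) (negbTE nw12) (negbTE nb12).
Qed.

Lemma stuck_clique r : r <= #|outer G C u| -> r <= #|outer G C z| ->
  exists2 K : {set V}, #|K| = r.+1 & clique G K.
Proof.
have out v : v \in C -> v \notin outer G C v by rewrite in_outer => ->.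
case: stuck_outer_clique => cl leu lez.
  by apply: (clique_of_nbrs sym (subsetDl _ _) (out u uC) cl leu).
by apply: (clique_of_nbrs sym (subsetDl _ _) (out z zC) cl lez).
Qed.

End Pair.

Definition dominant_pair r G C u z := [/\ #|C| = r.+1, forall x, degree G x <= degree G u,
  {in ~: C, forall y, degree G y <= degree G z}, r <= degree G z &
  {in C, forall c, c != u -> c != z -> r <= #|nbr G c :&: C| + 3}].

Lemma dominant_pair_rewiring r G G' C u z : rewiring G G' -> {in C &, subrel G G'} ->
  dominant_pair r G C u z -> dominant_pair r G' C u z.
Proof.
move=> [_ d] sub [cC umax outC rz inner]; split=> // [x|y yC||c cC' cu cz].
- by rewrite !d.
- by rewrite !d outC.
- by rewrite d.
apply: leq_trans (inner c cC' cu cz) _; rewrite leq_add2r; apply/subset_leq_card/subsetP => y.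
by rewrite !inE => /andP[g yC]; rewrite yC sub.
Qed.

Section DominantPair.
Variables (G : rel V) (C : {set V}) (u z : V) (r : nat).
Hypotheses (sG : sgraph G) (uC : u \in C) (zC : z \in C) (nuz : u != z).
Hypotheses (stuck : ~ addable G C u z) (dom : dominant_pair r G C u z).

Let sym : symmetric G. Proof. by case: sG. Qed.
Let irr : irreflexive G. Proof. by case: sG. Qed.
Let nguz : ~~ G u z := stuck_nonadj sG stuck.
Let outC y : y \notin C -> degree G y <= degree G z.
Proof. by case: dom => _ _ + _ _ yC; apply; rewrite inE. Qed.

Lemma stuck_outer_neq0 : outer G C u != set0 /\ outer G C z != set0.
Proof.
have [cC umax _ rz _] := dom; have nzu : z != u by rewrite eq_sym.
have ngzu : ~~ G z u by rewrite sym.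
have := degree_nonadj_le irr uC zC nuz nguz; have := degree_nonadj_le irr zC uC nzu ngzu.
by rewrite -!card_gt0 cC; have := umax z; lia.
Qed.

Lemma stuck_max_le : degree G u + 2 <= degree G z + r.
Proof.
have [cC _ _ _ _] := dom; have [_ /set0Pn [b bz]] := stuck_outer_neq0.
have := card_nbrI_nonadj irr uC zC nuz nguz; have := degree_split G C u; rewrite cC.
have [bC gzb] : b \notin C /\ G z b by move: bz; rewrite in_outer => /andP[].
suff: #|outer G C u| < degree G b by have := outC bC; lia.
have zout : z \notin outer G C u :\ b by rewrite !inE zC andbF.
have sub : z |: outer G C u :\ b \subset nbr G b.
  apply/subsetP => x /setU1P[->|/setD1P[nxb xu]]; rewrite inE sym //.
  exact: (stuck_adj sG nuz stuck).
have [gub|ngub] := boolP (G u b).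
  have /subset_leq_card : u |: (z |: outer G C u :\ b) \subset nbr G b.
    by rewrite subUset sub sub1set inE sym gub.
  rewrite !cardsU1 zout !inE (negbTE nuz) irr !andbF.
  by rewrite (cardsD1 b (outer G C u)) in_outer gub bC /degree; clear; lia.
move/subset_leq_card: sub; rewrite cardsU1 zout (cardsD1 b (outer G C u)) in_outer.
by rewrite (negbTE ngub) andbF /degree; clear; lia.
Qed.

Lemma stuck_card_outer c : c \in C -> c != u -> c != z -> #|outer G C c| <= (degree G z).+1.
Proof.
have [_ umax _ _ inner] := dom => c0 cu cz; have := inner c c0 cu cz; have := stuck_max_le.
by have := umax c; rewrite (degree_split G C c); lia.
Qed.

Lemma stuck_bound_cover w : w \in outer G C u ->
  (forall x, x \notin C -> G u x -> (x == w) || G w x) ->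
  (forall x y, G x y -> x \notin C -> y != z -> [|| x == w, G w x, y == w | G w y]) ->
  \sum_x degree G x + 4 <= r * r + 3 * r + 2 * (degree G z * degree G z).
Proof.
move=> wu nbr_u edges; have [cC _ _ _ _] := dom.
have [wC guw] : w \notin C /\ G u w by move: wu; rewrite in_outer => /andP[].
have nbr_z x : x \notin C -> G z x -> (x == w) || G w x.
  have [//|nxw] := eqVneq x w => xC gzx; apply: (stuck_adj sG nuz stuck) => //.
    by rewrite in_outer xC.
  by rewrite eq_sym.
apply: (@edge_cover_bound _ G C (nbr G w :&: C :\ u :\ z) (closed_outer G C w) u z) => //.
- by rewrite !setSD // subsetIr.
- move=> x y gxy xC; rewrite !in_closed_outer xC /=.
  have [yz|nyz] := eqVneq y z; first by rewrite nbr_z // sym -yz.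
  have [yu|nyu] := eqVneq y u; first by rewrite nbr_u // sym -yu.
  have := edges x y gxy xC nyz; rewrite !inE nyz nyu.
  have [->|_] := eqVneq y w; first by rewrite wC /= ?orbT.
  by case: (x == w); case: (G w x); case: (G w y); case: (y \in C).
- by move=> y; rewrite in_closed_outer => /andP[yC _]; apply: outC.
- by move=> c /setD1P[cz /setD1P[cu /setIP[_ c0]]]; apply: stuck_card_outer.
rewrite card_closed_outer //; have := outC wC; have := degree_split G C w.
have := cardsD1 u (nbr G w :&: C); have := cardsD1 z (nbr G w :&: C :\ u).
by rewrite !inE (sym w u) guw uC; clear; lia.
Qed.

Lemma stuck_bound_common w : w \in outer G C u -> w \in outer G C z ->
  \sum_x degree G x + 4 <= r * r + 3 * r + 2 * (degree G z * degree G z).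
Proof.
move=> wu wz; apply: (stuck_bound_cover wu) => [x xC gux|x y gxy xC _].
  have [//|nxw] := eqVneq x w; rewrite /= sym; apply: (stuck_adj sG nuz stuck) => //.
  by rewrite in_outer xC.
by apply: (stuck_edge sG uC zC nuz stuck) => //; left.
Qed.

Lemma stuck_bound_twin w b : w \in outer G C u -> b \in outer G C z -> w != b ->
  (forall x, G w x -> x != u -> (x == b) || G b x) ->
  (forall x, G b x -> x != z -> (x == w) || G w x) ->
  \sum_x degree G x + 4 <= r * r + 3 * r + 2 * (degree G z * degree G z).
Proof.
move=> wu bz nwb nbr_w nbr_b.
have gwb : G w b by apply: (stuck_adj sG nuz stuck).
apply: (stuck_bound_cover wu) => [x xC gux|x y gxy xC nyz].
  have [->|nxb] := eqVneq x b; first by rewrite gwb orbT.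
  apply: nbr_b; last by apply: contraNneq xC => ->.
  by rewrite sym; apply: (stuck_adj sG nuz stuck); rewrite // in_outer xC.
have := stuck_edge sG uC zC nuz stuck wu bz gxy (or_introl xC).
case/or4P => [->//|->|/eqP->|gby]; rewrite ?gwb ?orbT //.
by rewrite nbr_b // !orbT.
Qed.

End DominantPair.

Lemma stuck_bound_rewiring G G' C u z r w : u \in C -> z \in C -> u != z ->
  ~ addable G C u z -> dominant_pair r G C u z ->
  rewiring G G' -> {in C &, subrel G G'} -> w \notin C -> G' u w -> G' z w ->
  \sum_x degree G x + 4 <= r * r + 3 * r + 2 * (degree G z * degree G z).
Proof.
move=> uC zC nuz stuck dom rG sub wC guw gzw; have [sG' d] := rG.
rewrite -(rewiring_sum_degree rG) -!d.
apply: (@stuck_bound_common G' C u z r sG' uC zC nuz _ _ w); rewrite ?in_outer ?wC //.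
  by move=> /(addable_trans rG sub).
exact: dominant_pair_rewiring dom.
Qed.

(* Unless [w] and [b] have the same neighbours, a switch creates a common outer neighbour. *)
Lemma stuck_bound G C u z r : sgraph G -> u \in C -> z \in C -> u != z ->
  ~ addable G C u z -> dominant_pair r G C u z ->
  \sum_x degree G x + 4 <= r * r + 3 * r + 2 * (degree G z * degree G z).
Proof.
move=> sG uC zC nuz stuck dom; have [sym _] := sG.
have [/set0Pn [w wu] /set0Pn [b bz]] := stuck_outer_neq0 sG uC zC nuz stuck dom.
have [wz|nwz] := boolP (w \in outer G C z).
  exact: (stuck_bound_common _ _ _ _ stuck dom wu).
have [bu|nbu] := boolP (b \in outer G C u).
  exact: (stuck_bound_common _ _ _ _ stuck dom bu).
have nwb : w != b by apply: contraNneq nwz => ->.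
have [[wC guw] [bC gzb]] : (w \notin C /\ G u w) /\ (b \notin C /\ G z b).
  by move: wu bz; rewrite !in_outer => /andP[-> ->] /andP[-> ->].
have [ngzw ngub] : ~~ G z w /\ ~~ G u b by move: nwz nbu; rewrite !in_outer wC bC.
have outC t o : t \in C -> o \notin C -> t != o by move=> tC; apply: contraNneq => <-.
have [/existsP[x /and4P[gwx nxu nxb ngbx]]|same_w] :=
    boolP [exists x, [&& G w x, x != u, x != b & ~~ G b x]].
  apply: (@stuck_bound_rewiring _ (switch G z b x w) _ _ _ _ w uC zC nuz stuck dom) => //.
  - by apply: switch_rewiring; rewrite ?(sym x) ?(outC z w).
  - by apply: switch_keep_in; right.
  - apply: switch_keep => //; rewrite /same_pair.
      by rewrite (negbTE nuz) (negbTE (outC u b uC bC)).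
    by rewrite (eq_sym u x) (negbTE nxu) (negbTE (outC u w uC wC)).
  exact: switch_ad.
have [/existsP[x /and4P[gbx nxz nxw ngwx]]|same_b] :=
    boolP [exists x, [&& G b x, x != z, x != w & ~~ G w x]].
  apply: (@stuck_bound_rewiring _ (switch G u w x b) _ _ _ _ b uC zC nuz stuck dom) => //.
  - by apply: switch_rewiring; rewrite ?(sym x) ?(outC u b).
  - by apply: switch_keep_in; right.
  - exact: switch_ad.
  apply: switch_keep => //; rewrite /same_pair.
    by rewrite (eq_sym z u) (negbTE nuz) (negbTE (outC z w zC wC)).
  by rewrite (eq_sym z x) (negbTE nxz) (negbTE (outC z b zC bC)).
apply: (stuck_bound_twin sG uC zC nuz stuck dom wu bz nwb) => x g nx.
  apply/negPn/negP; rewrite negb_or => /andP[nxb ngbx].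
  by case/existsP: same_w; exists x; rewrite g nx nxb.
apply/negPn/negP; rewrite negb_or => /andP[nxw ngwx].
by case/existsP: same_b; exists x; rewrite g nx nxw.
Qed.

End Stuck.

(** * Removing a vertex of maximum degree *)

Section DeleteVertex.
Variable V : finType.
Implicit Types (G : rel V) (C T U : {set V}).

Definition del_vertex G v : rel V := fun x y => [&& G x y, x != v & y != v].

Lemma del_vertex_sgraph G v : sgraph G -> sgraph (del_vertex G v).
Proof.
move=> [sym irr]; split=> [x y|x]; rewrite /del_vertex ?irr //.
by rewrite sym; case: (x != v); case: (y != v); rewrite ?andbF.
Qed.

Lemma del_vertex_supported G U v : supported G U -> supported (del_vertex G v) (U :\ v).
Proof. by move=> inU x y /and3P[g nx _]; rewrite !inE nx (inU x y). Qed.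

Lemma degree_del_vertex_self G v : degree (del_vertex G v) v = 0.
Proof. by apply: eq_card0 => y; rewrite !inE /del_vertex eqxx andbF. Qed.

Lemma degree_del_vertex G v x : symmetric G -> x != v ->
  degree G x = degree (del_vertex G v) x + G v x.
Proof.
move=> sym nx; rewrite /degree (cardsD1 v) in_nbr addnC (sym x); congr (_ + _).
by apply: eq_card => y; rewrite !inE /del_vertex nx andbC.
Qed.

Lemma sum_degree_del_vertex G v : sgraph G ->
  \sum_x degree G x = \sum_x degree (del_vertex G v) x + 2 * degree G v.
Proof.
move=> [sym irr]; rewrite (bigD1 v) // [in RHS](bigD1 v) //= degree_del_vertex_self add0n.
rewrite (eq_bigr _ (fun x nx => degree_del_vertex sym nx)) big_split /=.
suff -> : \sum_(i | i != v) (G v i : nat) = degree G v by lia.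
by rewrite degree_sum [RHS](bigD1 v) //= irr add0n.
Qed.

Definition add_vertex G1 G v : rel V :=
  fun x y => [|| G1 x y, (x == v) && G v y | (y == v) && G v x].

Lemma add_vertex_rewiring G1 G v : sgraph G -> rewiring (del_vertex G v) G1 ->
  rewiring G (add_vertex G1 G v).
Proof.
move=> [sym irr] [[sym1 irr1] d1].
have iso y : G1 v y = false.
  apply/negP => g1vy; have : 0 < degree G1 v by apply/degree_gt0P; exists y.
  by rewrite d1 degree_del_vertex_self.
have sym2 : symmetric (add_vertex G1 G v).
  by move=> x y; rewrite /add_vertex sym1; congr (_ || _); rewrite orbC.
have vE x : add_vertex G1 G v v x = G v x.
  by rewrite /add_vertex iso eqxx irr andbF orbF.
split; first split=> // x.
  by rewrite /add_vertex irr1 /= orbb; case: eqVneq => //= ->; rewrite irr.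
move=> x; have [->|nx] := eqVneq x v; first by apply: eq_card => y; rewrite !inE vE.
rewrite (degree_del_vertex sym nx) -d1 /degree (cardsD1 v) in_nbr sym2 vE addnC; congr (_ + _).
apply: eq_card => y; rewrite !inE /add_vertex (negbTE nx) /=.
by case: (eqVneq y v) => [->|ny] /=; rewrite ?orbF // sym1 iso.
Qed.

End DeleteVertex.

Section Peel.
Variable V : finType.
Implicit Types (G : rel V) (C T U : {set V}).

Definition potentially_K3P3_clique G U k := exists G' C,
  [/\ rewiring G G', C \subset U, #|C| = k & K3P3_clique G' C].

(* [s >= (r - 1)(2 n - r) - 3 (n - r) - 1] without truncated subtraction. *)
Definition heavy r n s := 2 * r * n + 4 * r <= s + r * r + 1 + 5 * n.

(* The bound [r + 42] is only effective for [r < 6]: it is what remains of [n >= 5 r + 18]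
   when the induction descends from some [r >= 6]. *)
Definition dense r G U := [/\ sgraph G, supported G U, 5 * r + 18 <= #|U|, r + 42 <= #|U| &
  heavy r #|U| (\sum_x degree G x)].

(* Degree in [G - v], ties broken in favour of the neighbours of [v]. *)
Definition peel_key G v x := 2 * degree (del_vertex G v) x + G v x.

Lemma potentially_K3P3_clique_rewiring G G' U k : rewiring G G' ->
  potentially_K3P3_clique G' U k -> potentially_K3P3_clique G U k.
Proof.
by move=> rG [G'' [C [rG' CU cC g]]]; exists G'', C; split=> //; apply: rewiring_trans rG'.
Qed.

Lemma dense_rewiring r G G' U : rewiring G G' -> dense r G U -> dense r G' U.
Proof.
move=> rG [sG inU U5 U42 hvy]; split=> //; first by case: rG.
  exact: rewiring_supported inU.
by rewrite (rewiring_sum_degree rG).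
Qed.

Lemma K3P3_clique_top G U k (key : V -> nat) :
  (forall x y, key x < key y -> degree G x <= degree G y) ->
  potentially_K3P3_clique G U k -> exists G' T,
    [/\ rewiring G G', T \subset U, #|T| = k, K3P3_clique G' T &
        {in T & U :\: T, forall x y, key y <= key x}].
Proof.
move=> key_deg [G0 [T0 init]].
have [|[G1 T] /= [rG TU cT g1] Tmax] := @exists_maximizer (rel V * {set V})
    (fun p => [/\ rewiring G p.1, p.2 \subset U, #|p.2| = k & K3P3_clique p.1 p.2])
    (fun p => \sum_(x in p.2) key x) (\sum_x key x) (ex_intro _ (G0, T0) init).
  by move=> [p1 p2] _ /=; rewrite [X in _ <= X](bigID (mem p2)) /= leq_addr.
exists G1, T; split=> // x y xT /setDP[yU yT]; rewrite leqNgt; apply/negP => ltxy.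
have [s1 d1] := rG.
have [|G2 rG2 g2] := @K3P3_clique_move _ G1 T x y s1 xT yT _ g1; first by rewrite !d1 key_deg.
have yTx : y \notin T :\ x by rewrite !inE (negbTE yT) andbF.
have swapU : y |: T :\ x \subset U.
  by rewrite subUset sub1set yU (subset_trans (subsetDl _ _)).
have swap_card : #|y |: T :\ x| = k by rewrite cardsU1 yTx -cT (cardsD1 x T) xT.
have := Tmax (G2, y |: T :\ x) (And4 (rewiring_trans rG rG2) swapU swap_card g2).
by rewrite /= big_setU1 //= [X in _ <= X](big_setD1 x) //= leq_add2r leqNgt ltxy.
Qed.

(* Take a rewiring in which [v] has as many neighbours in [T] as possible. *)
Lemma K3P3_clique_extend_or_stuck G T v : sgraph G -> v \notin T -> K3P3_clique G T ->
  (exists2 G', rewiring G G' & K3P3_clique G' (v |: T)) \/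
  exists G' z, [/\ rewiring G G', {in v |: T &, subrel G G'}, z \in T &
                   ~ addable G' (v |: T) v z].
Proof.
move=> sG vT g; pose C := v |: T.
have TC x : x \in T -> x \in C by apply: setU1r.
have [||G' /= [rG sub] Gmax] := @exists_maximizer (rel V)
    (fun H => rewiring G H /\ {in C &, subrel G H}) (fun H => #|nbr H v :&: T|) #|T|.
- by exists G; split=> // [|x y].
- by move=> H _; apply/subset_leq_card/subsetIr.
have [sG' _] := rG; have [sym' _] := sG'.
have g' : K3P3_clique G' T.
  by apply: K3P3_clique_sub g => x y xT yT; apply: sub; apply: TC.
have [dom|] := boolP [forall (x | x \in T), G' v x].
  left; exists G' => //; apply: K3P3_clique_setU1 => // x xT.
  by have /implyP := forallP dom x; apply.
rewrite negb_forall => /existsP [z]; rewrite negb_imply => /andP[zT ngvz].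
right; exists G', z; split=> // -[G2 [rG2 sub2 g2vz]].
have : #|nbr G2 v :&: T| <= #|nbr G' v :&: T|.
  apply: Gmax; split; first exact: rewiring_trans rG2.
  by move=> x y xC yC gxy; apply: sub2 => //; apply: sub.
rewrite leqNgt => /negP; apply; apply: proper_card; apply/properP; split.
  apply/subsetP => y; rewrite !inE => /andP[gvy yT]; rewrite yT andbT.
  by apply: sub2 => //; [apply: setU11 | apply: TC].
by exists z; rewrite !inE ?g2vz ?zT // (negbTE ngvz).
Qed.

Lemma dominant_pair_peel r G G' U T v z :
  sgraph G -> supported G U -> (forall x, degree G x <= degree G v) ->
  r.+1 < #|[set x | r < degree G x]| ->
  {in T & (U :\ v) :\: T, forall x y, peel_key G v y <= peel_key G v x} ->
  rewiring G G' -> K3P3_clique G' T -> v \notin T -> #|T| = r.+1 -> z \in T -> ~~ G v z ->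
  dominant_pair r.+1 G' (v |: T) v z.
Proof.
move=> sG inU vmax many keyle [[_ irr'] d'] g' vT cT zT ngvz; have [sym _] := sG.
have cC : #|v |: T| = r.+2 by rewrite cardsU1 vT cT.
have nzv : z != v by apply: contraNneq vT => <-.
have out y : y \notin v |: T -> degree G y <= degree G z.
  rewrite in_setU1 negb_or => /andP[nyv yT].
  have [yU|yU] := boolP (y \in U); last by rewrite (degree_notin inU yU).
  have := keyle z y zT; rewrite !inE yT nyv yU => /(_ isT); rewrite /peel_key.
  rewrite (degree_del_vertex sym nyv) (degree_del_vertex sym nzv) (negbTE ngvz).
  by case: (G v y); lia.
split=> // [x|y yC||c].
- by rewrite !d'.
- by rewrite !d' out // -in_setC.
- rewrite d' ltnNge; apply/negP => lez.
  have : [set x | r < degree G x] \subset (v |: T) :\ z.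
    apply/subsetP => x; rewrite inE => ltx; rewrite in_setD1; apply/andP; split.
      by apply: contraTneq ltx => ->; rewrite -leqNgt.
    by apply: contraLR (leq_ltn_trans lez ltx) => /out; rewrite leqNgt.
  move/subset_leq_card; have := cardsD1 z (v |: T).
  by rewrite cC setU1r //=; lia.
move=> /setU1P[->|cT0] ncv _; first by rewrite eqxx in ncv.
have := embeds_K3P3_degree c g'; have := nonadj_degree irr' cT0; rewrite cT.
have : #|nbr G' c :&: T| <= #|nbr G' c :&: (v |: T)|.
  by apply/subset_leq_card/setIS/subsetUr.
lia.
Qed.

Lemma stuck_potentially_K3P3_clique r G U C u z : 2 <= r -> dense r.+1 G U ->
  u \in C -> z \in C -> u != z -> ~ addable G C u z -> dominant_pair r.+1 G C u z ->
  potentially_K3P3_clique G U r.+2.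
Proof.
move=> r2 [sG inU U5 U42 hvy] uC zC nuz stuck dom; have [sym irr] := sG.
have [big|small] := leqP (2 * r + 1) (degree G z); last first.
  have := stuck_bound sG uC zC nuz stuck dom.
  by move: hvy small U5 U42 r2; rewrite /heavy; clear; have [r3|r3] := leqP 3 r; nia.
have [outu outz] : r.+1 <= #|outer G C u| /\ r.+1 <= #|outer G C z|.
  have [cC umax _ _ _] := dom; have nguz := stuck_nonadj sG stuck.
  have nzu : z != u by rewrite eq_sym.
  have ngzu : ~~ G z u by rewrite sym.
  have := degree_nonadj_le irr uC zC nuz nguz; have := degree_nonadj_le irr zC uC nzu ngzu.
  by rewrite cC; have := umax z; lia.
have [K cK clK] := stuck_clique sG uC zC nuz stuck outu outz.
exists G, K; split=> //; last exact: K3P3_clique_complete.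
by apply: clique_subset_supported clK _; rewrite ?cK.
Qed.

Lemma potentially_K3P3_clique_many_high r G U : 2 <= r ->
  (forall G U, dense r G U -> potentially_K3P3_clique G U r.+1) ->
  dense r.+1 G U -> r.+1 < #|[set x | r < degree G x]| -> potentially_K3P3_clique G U r.+2.
Proof.
move=> r2 IH dG many; have [sG inU U5 U42 hvy] := dG; have [sym irr] := sG.
have /card_gt0P [v0 v0P] : 0 < #|[set x | r < degree G x]| by lia.
have [v _ /(_ _ isT) vmax] := @arg_maxnP V v0 predT (degree G) isT.
have vdeg : r < degree G v by apply: leq_trans (vmax v0); rewrite inE in v0P.
have vU : v \in U by apply: (supported_degree inU); lia.
have cU := cardsD1 v U; rewrite vU /= in cU.
have dvU : degree G v < #|U|.
  rewrite /degree (_ : nbr G v = nbr G v :&: U).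
    exact: card_nbrI_lt.
  by apply/esym/setIidPl/subsetP => y; rewrite inE sym; apply: inU.
have [||G1 [T [rG1 TU cT g1 keyle]]] :=
    @K3P3_clique_top (del_vertex G v) (U :\ v) r.+1 (peel_key G v).
- by move=> x y; rewrite /peel_key; case: (G v x); case: (G v y); lia.
- apply: IH; split; [exact: del_vertex_sgraph | exact: del_vertex_supported | lia | lia |].
  by move: hvy; rewrite /heavy (sum_degree_del_vertex v sG) cU; lia.
have vT : v \notin T by apply/negP => /(subsetP TU); rewrite !inE eqxx.
have CU : v |: T \subset U by rewrite subUset sub1set vU (subset_trans TU) // subsetDl.
have cC : #|v |: T| = r.+2 by rewrite cardsU1 vT cT.
have rG2 := add_vertex_rewiring sG rG1.
have g2 : K3P3_clique (add_vertex G1 G v) T.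
  by apply: K3P3_clique_sub g1 => x y _ _ g; rewrite /add_vertex g.
have [[G3 rG3 g3]|[G3 [z [rG3 sub zT stuck]]]] := K3P3_clique_extend_or_stuck rG2.1 vT g2.
  by exists G3, (v |: T); split=> //; apply: rewiring_trans rG3.
have rG := rewiring_trans rG2 rG3; have [s3 _] := rG; have [vC zC] := (setU11 v T, setU1r v zT).
have nvz : v != z by apply: contraNneq vT => ->.
have ngvz : ~~ G v z.
  apply: contra (stuck_nonadj s3 stuck) => gvz; apply: sub => //.
  by rewrite /add_vertex eqxx gvz orbT.
have g3 : K3P3_clique G3 T by apply: K3P3_clique_sub g2 => x y xT yT; apply: sub; apply: setU1r.
have dom := dominant_pair_peel sG inU vmax many keyle rG g3 vT cT zT ngvz.
apply: (potentially_K3P3_clique_rewiring rG).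
exact: stuck_potentially_K3P3_clique r2 (dense_rewiring rG dG) vC zC nvz stuck dom.
Qed.

End Peel.

(** * Few vertices of large degree *)

Lemma tail_not_heavy r n i j l s : i + j + 3 <= r -> l + 2 * i + 2 <= 2 * r ->
  5 * r + 18 <= n -> l + r.+1 <= n ->
  s <= r.+1 * r + l * (2 * (r - 1)) + (n - r.+1 - l) * (2 * i) + j * (r - 1) ->
  ~ heavy r n s.
Proof.
move=> ijr lir n5 ln les.
have [e rE] : exists e, r = i + e + 3 by exists (r - i - 3); lia.
have [m nE] : exists m, n = m + r + 1 + l by exists (n - r - 1 - l); lia.
have [rE1 nE1] : r - 1 = i + e + 2 /\ n - r.+1 - l = m by lia.
have jr : j * (r - 1) <= e * (i + e + 2) by apply: leq_mul; lia.
have ll : l * (2 * e) <= (2 * e + 4) * (2 * e) by apply: leq_mul; lia.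
have mm : (2 * e + 1) * (4 * i + 2 * e + 25) <= (2 * e + 1) * m by apply: leq_mul; lia.
rewrite nE1 rE1 in les jr; have {}les := leq_trans les (leq_add (leqnn _) jr).
rewrite /heavy nE rE; rewrite rE in les.
by move: les ll mm lir; rewrite rE; clear; lia.
Qed.

Section LowTail.
Variable V : finType.

Definition low_tail r (G : rel V) (U C : {set V}) :=
  [/\ [/\ C \subset U, #|C| = r.+1 & 5 * r + 18 <= #|U|], sgraph G, supported G U,
      forall y, y \notin C -> degree G y < r & heavy r #|U| (\sum_x degree G x)].

Lemma low_tail_rewiring r G G' U C : rewiring G G' -> low_tail r G U C -> low_tail r G' U C.
Proof.
move=> rG [card sG inU tail hvy]; have [sG' d'] := rG; split=> // [|y yC|].
- exact: rewiring_supported inU.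
- by rewrite d' tail.
- by rewrite (rewiring_sum_degree rG).
Qed.

Section StuckTail.
Variables (r : nat) (G : rel V) (U C : {set V}) (u z a b : V).
Hypotheses (tail : low_tail r G U C) (uC : u \in C) (zC : z \in C) (nuz : u != z).
Hypotheses (stuck : ~ addable G C u z) (au : a \in outer G C u) (bz : b \in outer G C z).

Let sG : sgraph G. Proof. by case: tail. Qed.
Let sym : symmetric G. Proof. by case: sG. Qed.
Let irr : irreflexive G. Proof. by case: sG. Qed.
Let aC : a \notin C. Proof. by move: au; rewrite in_outer => /andP[]. Qed.
Let gau : G a u. Proof. by move: au; rewrite in_outer sym => /andP[]. Qed.
Let bC : b \notin C. Proof. by move: bz; rewrite in_outer => /andP[]. Qed.
Let gbz : G b z. Proof. by move: bz; rewrite in_outer sym => /andP[]. Qed.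
Let degree_out y : y \notin C -> degree G y < r. Proof. by case: tail => _ _ _ + _; apply. Qed.
Let card_UC : #|U :\: C| = #|U| - r.+1.
Proof. by case: tail => -[CU cC _] _ _ _ _; rewrite cardsD (setIidPr CU) cC. Qed.

Let near := closed_outer G C a :|: closed_outer G C b.
Let common := nbr G a :&: nbr G b :\ u :\ z.

Lemma stuck_far_nbrs o : o \notin C -> o \notin near -> nbr G o \subset common.
Proof.
move=> oC; rewrite !inE oC /= !negb_or => /andP[/andP[noa ngao] /andP[nob ngbo]].
apply/subsetP => y; rewrite !inE => goy; have gyo : G y o by rewrite sym.
have gby : G b y.
  have := stuck_edge sG uC zC nuz stuck au bz goy (or_introl oC).
  rewrite (negbTE noa) (negbTE ngao) /= => /predU1P[yb|//].
  by rewrite -yb gyo in ngbo.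
have gay : G a y.
  have := stuck_edge sG uC zC nuz stuck au bz gyo (or_intror oC).
  rewrite (negbTE nob) (negbTE ngbo) !orbF => /predU1P[ya|//].
  by rewrite -ya gyo in ngao.
rewrite gay gby !andbT; apply/andP; split.
  apply: contraNneq ngao => yz; apply: (stuck_adj sG nuz stuck) => //; last by rewrite eq_sym.
  by rewrite in_outer oC -yz.
apply: contraNneq ngbo => yu; rewrite sym; apply: (stuck_adj sG nuz stuck) => //.
by rewrite in_outer oC -yu.
Qed.

Lemma stuck_card_common : #|common| + 2 <= degree G a.
Proof.
have [x [gax nxu sub]] : exists x, [/\ G a x, x != u & common \subset nbr G a :\ u :\ x].
  have [ab|nab] := eqVneq a b.
    exists z; split; [by rewrite ab | by rewrite eq_sym |].
    by apply/subsetP => y; rewrite !inE => /and4P[-> -> -> _].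
  exists b; split; first exact: (stuck_adj sG nuz stuck).
    by apply: contraNneq bC => ->.
  apply/subsetP => y; rewrite !inE => /and4P[_ -> -> gby]; rewrite !andbT.
  by apply: contraTneq gby => ->; rewrite irr.
have := subset_leq_card sub; have := cardsD1 u (nbr G a); have := cardsD1 x (nbr G a :\ u).
by rewrite !inE gau gax nxu /degree; clear; lia.
Qed.

Lemma stuck_card_near : #|near| + 2 * #|common :&: C| + 2 <= 2 * r.
Proof.
have card_closed x v : x \notin C -> v \in C -> G x v -> v \notin common ->
    common \subset nbr G x -> #|closed_outer G C x| + #|common :&: C| + 1 <= r.
  move=> xC vC gxv vW sW; rewrite card_closed_outer //.
  have : v |: (common :&: C) \subset nbr G x :&: C by rewrite subUset sub1set !inE gxv vC setSI.
  move/subset_leq_card; rewrite cardsU1 inE (negbTE vW).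
  by have := degree_out xC; rewrite (degree_split G C x) /=; clear; lia.
have ha : #|closed_outer G C a| + #|common :&: C| + 1 <= r.
  apply: (card_closed a u) => //; first by rewrite !inE eqxx !andbF.
  by apply/subsetP => y; rewrite !inE => /and4P[_ _ ->].
have hb : #|closed_outer G C b| + #|common :&: C| + 1 <= r.
  apply: (card_closed b z) => //; first by rewrite !inE eqxx.
  by apply/subsetP => y; rewrite !inE => /and4P[_ _ _ ->].
have := (leq_card_setU (closed_outer G C a) (closed_outer G C b)).1.
by move: ha hb; rewrite -/near; clear; lia.
Qed.

Lemma stuck_near_sub : near \subset U :\: C.
Proof.
have [_ _ inU _ _] := tail; rewrite /near -setDUl; apply: setSD.
apply/subsetP => x; rewrite !inE => /orP[]/orP[/eqP->|gx].
- exact: inU gau.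
- by apply: (inU x a); rewrite sym.
- exact: inU gbz.
- by apply: (inU x b); rewrite sym.
Qed.

Lemma stuck_far_bound x : x \in ~: C :\: near ->
  #|nbr G x :&: C| + degree G x <=
  (x \in U :\: C :\: near) * (2 * #|common :&: C|) + #|nbr G x :&: (common :\: C)|.
Proof.
have [_ _ inU _ _] := tail => /setDP[]; rewrite in_setC => xC xN.
have sW := stuck_far_nbrs xC xN.
have leC : #|nbr G x :&: C| <= #|common :&: C| by apply/subset_leq_card/setSI.
have outE : nbr G x :&: (common :\: C) = outer G C x by rewrite setIDA (setIidPl sW).
rewrite (degree_split G C x) outE in_setD xN in_setD xC /=.
have [xU|xU] := boolP (x \in U); first by move: leC; clear; lia.
by rewrite (nbr_notin inU xU) /outer (nbr_notin inU xU) set0I cards0.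
Qed.

Lemma stuck_sum_outside :
  \sum_(x in ~: C) (#|nbr G x :&: C| + degree G x) <=
    #|near| * (2 * (r - 1)) + (#|U| - r.+1 - #|near|) * (2 * #|common :&: C|)
    + #|common :\: C| * (r - 1).
Proof.
have nearC : near \subset ~: C by rewrite /near -setDUl; apply: subsetDr.
rewrite (big_setID near) /= (setIidPr nearC) -addnA; apply: leq_add.
  rewrite -sum_nat_const; apply: leq_sum => x /(subsetP nearC); rewrite inE => /degree_out.
  by rewrite (degree_split G C x); clear; lia.
apply: (@leq_trans (\sum_(x in ~: C :\: near) ((x \in U :\: C :\: near) * (2 * #|common :&: C|)
    + #|nbr G x :&: (common :\: C)|))).
  by apply: leq_sum => x; apply: stuck_far_bound.
rewrite big_split /=; apply: leq_add.
  rewrite -big_distrl /= leq_mul2r; apply/orP; right.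
  rewrite -card_UC (_ : _ - _ = #|U :\: C :\: near|).
    rewrite card_sum_mem big_mkcond /=.
    by apply: leq_sum => x _; case: ifP.
  by rewrite [RHS]cardsD (setIidPr stuck_near_sub).
apply: (@leq_trans (\sum_(x in ~: C) #|nbr G x :&: (common :\: C)|)).
  by rewrite [X in _ <= X](big_setID near) /= leq_addl.
rewrite -card_arcs card_arcsC // card_arcs -sum_nat_const; apply: leq_sum => x /setDP[_ xC].
by have := degree_out xC; rewrite (degree_split G (~: C) x); clear; lia.
Qed.

Lemma stuck_tail_false : False.
Proof.
have [[CU cC U5] _ _ _ hvy] := tail.
have leN : #|near| + r.+1 <= #|U|.
  by have := subset_leq_card stuck_near_sub; rewrite card_UC; move: U5; clear; lia.
apply: (@tail_not_heavy r #|U| #|common :&: C| #|common :\: C| #|near| _ _ _ U5 leN _ hvy).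
- by have := stuck_card_common; have := degree_out aC; have := cardsID C common; clear; lia.
- exact: stuck_card_near.
have inC : \sum_(x in C) #|nbr G x :&: C| <= r.+1 * r.
  rewrite -cC -sum_nat_const; apply: leq_sum => x xC.
  by have := card_nbrI_lt irr xC; rewrite cC.
by rewrite (sum_degree_split C sym); have := stuck_sum_outside; move: inC; clear; lia.
Qed.

End StuckTail.

Lemma open_addable r G U C u z : low_tail r G U C -> u \in C -> z \in C -> u != z ->
  outer G C u != set0 -> outer G C z != set0 -> addable G C u z.
Proof.
move=> tail uC zC nuz /set0Pn [a au] /set0Pn [b bz]; apply: NNPP => stuck.
exact: stuck_tail_false tail uC zC nuz stuck au bz.
Qed.

End LowTail.

(** * Graphs with at most three edges *)

Section FewEdges.
Variable V : finType.
Implicit Types (M : rel V) (K : {set V}) (l : seq (V * V)).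

Lemma sum_degree_even M : sgraph M -> ~~ odd (\sum_x degree M x).
Proof.
move=> sM; have [k] := ubnP (\sum_x degree M x); elim: k M sM => // k IH M sM ltk.
have [/existsP [v dv]|/existsPn none] := boolP [exists v, 0 < degree M v].
  move: ltk; rewrite (sum_degree_del_vertex v sM) => ltk.
  by rewrite oddD oddM addbF IH //; [exact: del_vertex_sgraph | lia].
by rewrite big1 // => v _; apply/eqP; rewrite eqn0Ngt none.
Qed.

Lemma nbr_unique M x y z : degree M x <= 1 -> M x y -> M x z -> y = z.
Proof. by move=> /card_le1_eqP eq1 xy xz; apply: eq1; rewrite in_nbr. Qed.

Definition edges_in M l := forall x y, M x y -> has (fun e => same_pair e.1 e.2 x y) l.

Lemma edges_in_nil M : \sum_x degree M x = 0 -> edges_in M [::].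
Proof.
move/eqP; rewrite sum_nat_eq0 => /forallP d0 x y gxy.
by have := introT (degree_gt0P M x) (ex_intro _ y gxy); rewrite (eqP (d0 x)).
Qed.

Lemma edges_in_del_vertex M a b l : sgraph M -> degree M a <= 1 -> M a b ->
  edges_in (del_vertex M a) l -> edges_in M ((a, b) :: l).
Proof.
move=> [sym _] da gab cov x y gxy /=.
have [xa|nxa] := eqVneq x a.
  by rewrite xa in gxy *; rewrite (nbr_unique da gxy gab) /same_pair !eqxx.
have [ya|nya] := eqVneq y a.
  by rewrite ya sym in gxy *; rewrite (nbr_unique da gxy gab) /same_pair !eqxx orbT.
by rewrite cov ?orbT // /del_vertex gxy nxa.
Qed.

Lemma edges_in_pair M a b : sgraph M -> \sum_x degree M x <= 2 -> M a b ->
  edges_in M [:: (a, b)].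
Proof.
move=> sM + gab; rewrite (sum_degree_del_vertex a sM) => le2.
have da : 0 < degree M a by apply/degree_gt0P; exists b.
by apply: edges_in_del_vertex => //; [lia | apply: edges_in_nil; lia].
Qed.

Definition endpoints l := flatten [seq [:: e.1; e.2] | e <- l].

Lemma matching_edges M : sgraph M -> (forall x, degree M x <= 1) ->
  exists l, [/\ edges_in M l, uniq (endpoints l), {in endpoints l, forall x, 0 < degree M x} &
                2 * size l = \sum_x degree M x].
Proof.
move=> sM; have [k] := ubnP (\sum_x degree M x); elim: k M sM => // k IH M sM ltk deg1.
have [sym _] := sM.
have [/existsP [a da]|/existsPn none] := boolP [exists v, 0 < degree M v]; last first.
  have sum0 : \sum_x degree M x = 0.
    by rewrite big1 // => v _; apply/eqP; rewrite eqn0Ngt none.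
  by exists [::]; split=> //; apply: edges_in_nil.
have [b gab] := degree_gt0P _ _ da; have nab := adj_neq sM gab.
have ltdel : \sum_x degree (del_vertex M a) x < k.
  by have := sum_degree_del_vertex a sM; lia.
have le_del x : degree (del_vertex M a) x <= degree M x.
  have [->|nxa] := eqVneq x a; first by rewrite degree_del_vertex_self.
  by rewrite (degree_del_vertex sym nxa) leq_addr.
have [l [cov ul pos sz]] :=
  IH _ (del_vertex_sgraph a sM) ltdel (fun x => leq_trans (le_del x) (deg1 x)).
have notin x : degree (del_vertex M a) x = 0 -> x \notin endpoints l.
  by move=> dx; apply/negP => /pos; rewrite dx.
have deg_b : degree M b = degree (del_vertex M a) b + 1.
  by rewrite (@degree_del_vertex _ _ a) 1?eq_sym // gab.
have del_b : degree (del_vertex M a) b = 0 by have := deg1 b; rewrite deg_b; lia.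
exists ((a, b) :: l); split.
- exact: edges_in_del_vertex.
- by rewrite /= inE negb_or nab !notin ?degree_del_vertex_self.
- move=> x; rewrite !inE => /or3P[/eqP->|/eqP->|/pos dx]; rewrite ?deg_b ?addn1 //.
  exact: leq_trans (le_del x).
by rewrite /= mulnS sz (sum_degree_del_vertex a sM); have := deg1 a; lia.
Qed.

Lemma embeds_K3P3_edges M l (s : seq (V * nat)) :
  uniq (unzip1 s) -> uniq (unzip2 s) -> all (gtn 7) (unzip2 s) -> edges_in M l ->
  {in l, forall e, exists i j, [/\ (e.1, i) \in s, (e.2, j) \in s & K3P3_edge i j]} ->
  embeds_K3P3 M.
Proof.
move=> u1 u2 lt7 cov lab; apply: (embeds_K3P3_labels u1 u2 lt7) => x y /cov/hasP [e el].
have [i [j [ei ej ij]]] := lab e el.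
by case/same_pairP => -[-> ->]; [exists i, j | exists j, i; rewrite K3P3_edgeC].
Qed.

Lemma embeds_K3P3_triangle M a b c : uniq [:: a; b; c] ->
  edges_in M [:: (a, b); (a, c); (b, c)] -> embeds_K3P3 M.
Proof.
move=> u cov; apply: (@embeds_K3P3_edges _ _ [:: (a, 0); (b, 1); (c, 2)] u) cov _ => // e.
by rewrite !inE => /or3P[]/eqP->; [exists 0, 1 | exists 0, 2 | exists 1, 2];
  rewrite !inE /= !eqxx ?orbT.
Qed.

Lemma embeds_K3P3_path M a b c d : uniq [:: a; b; c; d] ->
  edges_in M [:: (a, b); (b, c); (c, d)] -> embeds_K3P3 M.
Proof.
move=> u cov.
apply: (@embeds_K3P3_edges _ _ [:: (a, 3); (b, 4); (c, 5); (d, 6)] u) cov _ => // e.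
by rewrite !inE => /or3P[]/eqP->; [exists 3, 4 | exists 4, 5 | exists 5, 6];
  rewrite !inE /= !eqxx ?orbT.
Qed.

Lemma embeds_K3P3_matching M : sgraph M -> \sum_x degree M x <= 6 ->
  (forall x, degree M x <= 1) -> embeds_K3P3 M.
Proof.
move=> sM le6 deg1; have [l [cov ul _ sz]] := matching_edges sM deg1.
have lel : size l <= 3 by lia.
apply: (@embeds_K3P3_edges _ l (zip (endpoints l) [:: 0; 1; 3; 4; 5; 6])) cov _;
  move: ul lel {sz}; case: l => [|[a b] [|[c d] [|[e f] [|]]]] //= _ _ p; rewrite !inE.
- by move/eqP->; exists 0, 1; rewrite !inE /= !eqxx ?orbT.
- by case/orP => /eqP->; [exists 0, 1 | exists 3, 4]; rewrite !inE /= !eqxx ?orbT.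
by case/or3P => /eqP->; [exists 0, 1 | exists 3, 4 | exists 5, 6]; rewrite !inE /= !eqxx ?orbT.
Qed.

Lemma embeds_K3P3_cherry M x y z p q : uniq [:: x; y; z] -> p != q -> p != x -> q != x ->
  edges_in M [:: (x, y); (x, z); (p, q)] -> embeds_K3P3 M.
Proof.
rewrite /= !inE !negb_or => /and3P[/andP[nxy nxz] nyz _] npq npx nqx cov.
have [nyx nzx nzy] : [/\ y != x, z != x & z != y] by rewrite (eq_sym y) !(eq_sym z).
have pend b c q' : b != x -> c != x -> c != b -> q' != x -> q' != b -> q' != c ->
    edges_in M [:: (x, b); (x, c); (b, q')] -> embeds_K3P3 M.
  move=> nbx ncx ncb nqx' nqb nqc cov'; apply: (@embeds_K3P3_path _ q' b x c).
    by rewrite /= !inE !negb_or nqb nqx' nqc nbx !(eq_sym _ c) ncb ncx.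
  move=> s t /cov' /=; rewrite (same_pair_rev x b) (same_pair_rev b q') !orbF.
  by case/or3P=> ->; rewrite ?orbT.
have cov_qp : edges_in M [:: (x, y); (x, z); (q, p)].
  by move=> s t /cov /=; rewrite (same_pair_rev q).
have cov_zy e : edges_in M [:: (x, y); (x, z); e] -> edges_in M [:: (x, z); (x, y); e].
  by move=> cov' s t /cov' /=; rewrite orbCA.
have triangle : edges_in M [:: (x, y); (x, z); (y, z)] -> embeds_K3P3 M.
  by apply: embeds_K3P3_triangle; rewrite /= !inE negb_or nxy nxz nyz.
have [py|npy] := eqVneq p y; have [qz|nqz] := eqVneq q z.
- by rewrite py qz in cov; apply: triangle.
- by rewrite py in npq cov; apply: (pend y z q); rewrite // eq_sym.
- have [pz|npz] := eqVneq p z; first by rewrite pz qz eqxx in npq.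
  by rewrite qz in cov_qp; apply: (pend z y p) (cov_zy _ cov_qp); rewrite // eq_sym.
have [pz|npz] := eqVneq p z; have [qy|nqy] := eqVneq q y.
- by rewrite pz qy in cov_qp; apply: triangle.
- by rewrite pz in npq cov; apply: (pend z y q) (cov_zy _ cov); rewrite // eq_sym.
- by rewrite qy in cov_qp; apply: (pend y z p).
apply: (@embeds_K3P3_edges _ _ [:: (x, 0); (y, 1); (z, 2); (p, 3); (q, 4)] _ _ _ cov) => //.
  rewrite /= !inE !negb_or nxy nxz nyz npq !(eq_sym x) !(eq_sym y) !(eq_sym z).
  by rewrite npx nqx npy nqy npz nqz.
move=> e; rewrite !inE => /or3P[]/eqP->; [exists 0, 1 | exists 0, 2 | exists 3, 4];
  by rewrite !inE /= !eqxx ?orbT.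
Qed.

Lemma embeds_K3P3_small M : sgraph M -> \sum_x degree M x <= 6 ->
  (forall x, degree M x <= 2) -> embeds_K3P3 M.
Proof.
move=> sM le6 deg2; have [sym _] := sM.
have [/forallP deg1|] := boolP [forall x, degree M x <= 1].
  exact: embeds_K3P3_matching.
rewrite negb_forall => /existsP [x]; rewrite -ltnNge => dx.
have /eqP/cards2P [y [z [nyz nbrx]]] : degree M x = 2 by apply/eqP; rewrite eqn_leq deg2.
have [gxy gxz] : M x y /\ M x z by rewrite -!in_nbr nbrx !inE !eqxx orbT.
have u : uniq [:: x; y; z] by rewrite /= !inE negb_or nyz !(adj_neq sM).
have star s t : M s t -> (s == x) || (t == x) -> same_pair x y s t || same_pair x z s t.
  move=> gst /orP[]/eqP E; rewrite E in gst *.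
    by move: gst; rewrite -in_nbr nbrx !inE /same_pair eqxx => /orP[]->; rewrite ?orbT.
  by move: gst; rewrite sym -in_nbr nbrx !inE /same_pair eqxx => /orP[]->; rewrite ?orbT.
have sum_del : \sum_v degree (del_vertex M x) v <= 2.
  by have := sum_degree_del_vertex x sM; lia.
have sdel := del_vertex_sgraph x sM.
have [/existsP [[p q] /= dpq]|none] := boolP [exists e : V * V, del_vertex M x e.1 e.2].
  have [_ npx nqx] := and3P dpq.
  apply: (embeds_K3P3_cherry u (adj_neq sdel dpq) npx nqx) => s t gst /=.
  have [/(star s t gst)/orP[]->|] := boolP ((s == x) || (t == x)); rewrite ?orbT //.
  rewrite negb_or => /andP[nsx ntx].
  have := edges_in_pair sdel sum_del dpq (x := s) (y := t); rewrite /del_vertex gst nsx ntx.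
  by move=> /(_ isT)/= ->; rewrite !orbT.
apply: (embeds_K3P3_triangle u) => s t gst /=.
have [/(star s t gst)/orP[]->|] := boolP ((s == x) || (t == x)); rewrite ?orbT //.
rewrite negb_or => /andP[nsx ntx]; case/existsP: none.
by exists (s, t); rewrite /del_vertex gst nsx.
Qed.

Definition vertex_cover M K := forall x y, M x y -> x \in K \/ y \in K.

Definition exposed M K := [set q in K | outer M K q != set0].

Lemma sum_degree_vertex_cover M K : sgraph M -> vertex_cover M K ->
  \sum_x degree M x = \sum_(q in K) (#|nbr M q :&: K| + 2 * #|outer M K q|).
Proof.
move=> [sym _] cover; rewrite (sum_degree_split K sym) [RHS]big_split /=; congr (_ + _).
have -> : \sum_(x in ~: K) (#|nbr M x :&: K| + degree M x) = 2 * #|arcs M (~: K) K|.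
  rewrite card_arcs big_distrr /=; apply: eq_bigr => x; rewrite inE => xK.
  rewrite (degree_split M K x) (_ : outer M K x = set0) ?cards0; first by lia.
  by apply/setP => y; rewrite !inE; apply/negP => /andP[yK /cover[]]; apply/negP.
by rewrite card_arcsC // card_arcs big_distrr /=; apply: eq_bigr => q _; rewrite /outer setDE.
Qed.

(* With [p] exposed and [q] other vertices in the cover, the sum is at most
   [4 p - p (p - 1) + q (q - 1)], which is [6] or less when [p + q <= 3]. *)
Lemma sum_degree_exposed_clique M K : sgraph M -> vertex_cover M K ->
  #|K| <= 3 -> {in K, forall q, degree M q <= 2} ->
  clique M (exposed M K) -> \sum_x degree M x <= 6.
Proof.
move=> sM cover K3 deg2; have [sym irr] := sM.
set P := exposed M K => clP; pose Q := K :\: P.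
have PK : P \subset K by apply/subsetP => q; rewrite inE => /andP[].
have split_nbr q : #|nbr M q :&: K| = #|nbr M q :&: P| + #|nbr M q :&: Q|.
  by rewrite -(cardsID P (_ :&: K)) -setIA (setIidPr PK) setIDA.
have sumP : \sum_(q in P) (#|nbr M q :&: K| + 2 * #|outer M K q|)
    + (#|arcs M P P| + #|arcs M P Q|) <= 4 * #|P|.
  rewrite !card_arcs -!big_split /= mulnC -sum_nat_const.
  apply: leq_sum => q /(subsetP PK) qK.
  by have := deg2 q qK; rewrite (degree_split M K q) split_nbr; clear; lia.
have sumQ : \sum_(q in Q) (#|nbr M q :&: K| + 2 * #|outer M K q|) =
    #|arcs M P Q| + #|arcs M Q Q|.
  rewrite (card_arcsC P) // !card_arcs -big_split /=; apply: eq_bigr => q.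
  rewrite !inE => /andP[+ qK]; rewrite qK negbK => /eqP->.
  by rewrite cards0 split_nbr addn0.
have PP : #|arcs M P P| = #|P| * (#|P| - 1).
  rewrite card_arcs -sum_nat_const; apply: eq_bigr => q qP; rewrite (cardsD1 q P) qP addKn.
  apply: eq_card => y; rewrite !inE; case: (eqVneq y q) => [->|nyq]; first by rewrite irr.
  case: (boolP (y \in K)) => yK; rewrite ?andbF //=.
  case: eqVneq; rewrite ?andbF //= andbT => yout.
  by apply: clP; rewrite // 1?eq_sym // inE yK.
have QQ : #|arcs M Q Q| <= #|Q| * (#|Q| - 1).
  rewrite card_arcs -sum_nat_const; apply: leq_sum => q qQ.
  by have := card_nbrI_lt irr qQ; clear; lia.
have cPQ : #|P| + #|Q| <= 3 by rewrite -(setIidPr PK) cardsID.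
have {PP QQ sumP sumQ} : \sum_(q in K) (#|nbr M q :&: K| + 2 * #|outer M K q|)
    + #|P| * (#|P| - 1) <= 4 * #|P| + #|Q| * (#|Q| - 1).
  rewrite (big_setID P) /= (setIidPr PK) -/Q sumQ.
  by move: sumP QQ; rewrite PP; clear; lia.
rewrite -(sum_degree_vertex_cover sM cover); move: cPQ; clear.
by case: #|P| => [|[|[|[|p]]]]; case: #|Q| => [|[|[|[|q]]]]; lia.
Qed.

Lemma sum_degree_small_cover M K : sgraph M -> vertex_cover M K ->
  #|K| <= 3 -> {in K, forall q, degree M q <= 2} ->
  (forall q q' x x', q \in K -> q' \in K -> q != q' -> ~~ M q q' ->
    x \in outer M K q -> x' \in outer M K q' -> x = x' /\ #|K| < 3) ->
  \sum_x degree M x <= 6.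
Proof.
move=> sM cover K3 deg2 same; have [sym irr] := sM.
have [cl|] := classic (clique M (exposed M K)).
  exact: sum_degree_exposed_clique sM cover K3 deg2 cl.
move=> ncl; have [q [q' [[qK q'K nqq'] [ngqq' [x xq] [x' x'q']]]]] : exists q q',
    [/\ q \in K, q' \in K & q != q'] /\
    [/\ ~~ M q q', exists x, x \in outer M K q & exists x, x \in outer M K q'].
  apply: NNPP => no; apply: ncl => q q'; rewrite !inE => /andP[qK /set0Pn oq].
  move=> /andP[q'K /set0Pn oq'] nqq'; apply/negPn/negP => ng; apply: no.
  by exists q, q'.
have [_ K2] := same q q' x x' qK q'K nqq' ngqq' xq x'q'.
have KE : K = [set q; q'].
  by apply/esym/eqP; rewrite eqEcard subUset !sub1set qK q'K cards2 nqq'.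
have out1 : #|outer M K q| <= 1 /\ #|outer M K q'| <= 1.
  split; apply/card_le1_eqP => y y' yq y'q.
    have [-> _] := same q q' y x' qK q'K nqq' ngqq' yq x'q'.
    by have [-> _] := same q q' y' x' qK q'K nqq' ngqq' y'q x'q'.
  have [<- _] := same q q' x y qK q'K nqq' ngqq' xq yq.
  by have [<- _] := same q q' x y' qK q'K nqq' ngqq' xq y'q.
have in0 p : p \in [set q; q'] -> nbr M p :&: [set q; q'] = set0.
  move=> /set2P pE; apply/setP => y; rewrite !inE.
  apply/negP => /andP[gpy /orP[]/eqP yE]; move: gpy;
  by rewrite yE; case: pE => ->; rewrite ?irr ?(sym q') ?(negbTE ngqq').
rewrite (sum_degree_vertex_cover sM cover) KE big_setU1 ?inE //= big_set1.
by rewrite !in0 ?set21 ?set22 // cards0 -KE; case: out1; clear; lia.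
Qed.

End FewEdges.

(** * Nonadjacent pairs among the largest degrees *)

Lemma heavy_deficit_le r n m s t p : 3 <= r -> r.+1 <= n -> s + m = r.+1 * r ->
  t <= (n - r.+1) * (2 * r - 5) + p -> heavy r n (s + t) -> m <= 6 + p.
Proof.
move=> r3 rn; have [e rE] : exists e, r = e + 3 by exists (r - 3); lia.
have [k nE] : exists k, n = k + r.+1 by exists (n - r.+1); lia.
rewrite /heavy {}nE {}rE addnK (_ : 2 * (e + 3) - 5 = 2 * e + 1); last by lia.
clear; lia.
Qed.

Section InnerArcs.
Variable V : finType.
Implicit Types (G : rel V) (C : {set V}).

Definition inner_maximal G C := forall G', rewiring G G' -> #|arcs G' C C| <= #|arcs G C C|.

Lemma exists_inner_maximal G C : sgraph G -> exists2 G', rewiring G G' & inner_maximal G' C.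
Proof.
move=> sG; have [||G' rG max'] := @exists_maximizer (rel V) (rewiring G)
    (fun H => #|arcs H C C|) #|[set: V * V]|.
- by exists G.
- by move=> H _; apply: subset_leq_card; apply: subsetT.
by exists G' => // G'' rG'; apply: max'; apply: rewiring_trans rG'.
Qed.

Lemma card_arcs_lt G G' C u v : {in C &, subrel G G'} -> u \in C -> v \in C ->
  ~~ G u v -> G' u v -> #|arcs G C C| < #|arcs G' C C|.
Proof.
move=> sub uC vC nguv guv; apply: proper_card; apply/properP; split.
  by apply/subsetP => -[x y]; rewrite !inE /= => /and3P[xC yC g]; rewrite xC yC sub.
by exists (u, v); rewrite !inE /= uC vC // (negbTE nguv).
Qed.

Lemma card_arcs_switch G C x a p q : sgraph G -> a \notin C -> x \in C -> q \in C ->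
  x != q -> ~~ G x q -> #|arcs G C C| <= #|arcs (switch G x a p q) C C|.
Proof.
move=> [sym _] aC xC qC nxq ngxq; pose A := arcs G C C :\ (p, q) :\ (q, p).
have sub : (x, q) |: ((q, x) |: A) \subset arcs (switch G x a p q) C C.
  apply/subsetP => -[y z]; rewrite !in_setU1 !in_setD1 !xpair_eqE !inE /=.
  case/or3P => [/andP[/eqP-> /eqP->]|/andP[/eqP-> /eqP->]|].
  - by rewrite xC qC switch_ad.
  - by rewrite xC qC /switch /same_pair !eqxx !orbT.
  case/and5P => nqp npq yC zC g; rewrite yC zC switch_keep //.
    by apply: (@same_pair_notin _ C) => //; right.
  by rewrite /same_pair negb_or npq nqp.
apply: leq_trans (subset_leq_card sub).
have := cardsD1 (p, q) (arcs G C C); have := cardsD1 (q, p) (arcs G C C :\ (p, q)).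
have xqA : (x, q) \notin A by rewrite !inE /= (negbTE ngxq) !andbF.
have qxA : (q, x) \notin A by rewrite !inE /= sym (negbTE ngxq) !andbF.
rewrite -/A !cardsU1 in_setU1 (negbTE xqA) qxA xpair_eqE (negbTE nxq) /=.
by case: (_ \in _); case: (_ \in _); clear; lia.
Qed.

End InnerArcs.

Section Deficit.
Variables (V : finType) (r : nat) (G : rel V) (U C : {set V}).
Hypotheses (r3 : 3 <= r) (tail : low_tail r G U C) (maxG : inner_maximal G C).
Local Notation co := (nonadj G C).

Let sG : sgraph G. Proof. by case: tail. Qed.
Let sym : symmetric G. Proof. by case: sG. Qed.
Let irr : irreflexive G. Proof. by case: sG. Qed.
Let cC : #|C| = r.+1. Proof. by case: tail => -[]. Qed.
Let sco : sgraph co. Proof. exact: nonadj_sgraph. Qed.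

Lemma degree_nonadj_outer x : x \in C -> degree G x + degree co x = r + #|outer G C x|.
Proof.
by move=> xC; have := nonadj_degree irr xC; rewrite cC (degree_split G C x); clear; lia.
Qed.

Lemma nonadj_outer_eq0 x y : co x y -> outer G C x != set0 -> outer G C y = set0.
Proof.
move=> /and4P[xC yC nxy ngxy] ox; apply/eqP/negPn/negP => oy.
have [G' [rG sub gxy]] := open_addable tail xC yC nxy ox oy.
by have := maxG rG; rewrite leqNgt (card_arcs_lt sub xC yC ngxy gxy).
Qed.

(* Switching [x a, q' q] into [x q, q' a] makes [x'] and [q'] both open. *)
Lemma nonadj_no_crossing q q' x x' : G q q' -> co q x -> co q' x' ->
  outer G C q = set0 -> outer G C q' = set0 -> outer G C x != set0 -> outer G C x' != set0 ->
  x != x' \/ 1 < #|outer G C x| -> False.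
Proof.
move=> gqq' /and4P[qC xC nqx ngqx] /and4P[q'C x'C nq'x' ngq'x'] oq oq' ox ox' hx.
have nxq : x != q by rewrite eq_sym.
have ngxq : ~~ G x q by rewrite sym.
have nq'x : q' != x by apply: contraNneq ox => <-; rewrite oq'.
have nqx' : q != x' by apply: contraNneq ox' => <-; rewrite oq.
have [a ax] := set0Pn _ ox; have [aC gxa] : a \notin C /\ G x a.
  by move: ax; rewrite in_outer => /andP[].
have outC t : t \in C -> t != a by move=> tC; apply: contraNneq aC => <-.
have ngq'a : ~~ G q' a by have /setP/(_ a) := oq'; rewrite in_outer inE aC => /= ->.
pose G1 := switch G x a q' q.
have rG : rewiring G G1 by apply: switch_rewiring; rewrite // ?outC // sym.
have nqq' : q' != q by rewrite eq_sym (adj_neq sG gqq').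
have ng1 : ~~ G1 q' x'.
  rewrite /G1 /switch (negbTE ngq'x') /same_pair orbF (negbTE nq'x) (negbTE nqq').
  by rewrite !(negbTE (outC _ _)) ?andbF.
have oq'1 : outer G1 C q' != set0.
  by apply/set0Pn; exists a; rewrite in_outer aC /G1 switch_cb.
have ox'1 : outer G1 C x' != set0.
  have [b] : exists b, (b \in outer G C x') && ((x' != x) || (b != a)).
    have [E|_] := eqVneq x' x; last by have [b bx'] := set0Pn _ ox'; exists b; rewrite bx'.
    have : 1 < #|outer G C x| by case: hx; rewrite // E eqxx.
    rewrite (cardsD1 a) ax ltnS => /card_gt0P [b]; rewrite in_setD1 => /andP[nba bx].
    by exists b; rewrite E bx nba.
  rewrite in_outer -andbA => /and3P[bC gx'b nxa]; apply/set0Pn; exists b.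
  rewrite in_outer bC /G1 switch_keep // /same_pair.
    by rewrite (negbTE (outC _ x'C)) orbF negb_and.
  by rewrite (eq_sym x' q') (negbTE nq'x') (eq_sym x' q) (negbTE nqx').
have [G2 [rG2 sub gq'x']] :=
  open_addable (low_tail_rewiring rG tail) q'C x'C nq'x' oq'1 ox'1.
have := maxG (rewiring_trans rG rG2); rewrite leqNgt => /negP; apply.
apply: leq_ltn_trans (card_arcs_switch q' sG aC xC qC nxq ngxq) _.
exact: card_arcs_lt sub q'C x'C ng1 gq'x'.
Qed.

Definition deficient := [set q in C | (outer G C q == set0) && (0 < degree co q)].
Local Notation D := deficient.

Lemma deficientP q :
  reflect [/\ q \in C, outer G C q = set0 & 0 < degree co q] (q \in deficient).
Proof. by rewrite inE; apply: (iffP and3P) => -[qC oq dq]; split=> //; apply/eqP. Qed.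

Lemma deficient_degree q : q \in D -> degree G q + degree co q = r.
Proof. by move=> /deficientP[qC oq _]; rewrite degree_nonadj_outer // oq cards0 addn0. Qed.

Lemma nonadj_notin_deficient x y : co x y -> y \notin D -> outer G C y != set0.
Proof.
move=> gxy; have /and4P[_ yC _ _] := gxy; apply: contra => /eqP oy; apply/deficientP.
by split=> //; apply/degree_gt0P; exists x; rewrite sco.1.
Qed.

Lemma deficient_cover : vertex_cover co D.
Proof.
move=> x y gxy; have [|yD] := boolP (y \in D); [by right | left].
have /and4P[xC _ _ _] := gxy; apply/deficientP; split=> //; last by apply/degree_gt0P; exists y.
by apply: nonadj_outer_eq0 (nonadj_notin_deficient gxy yD); rewrite sco.1.
Qed.

Lemma deficient_adj q q' : q \in D -> q' \in D -> q != q' -> ~~ co q q' -> G q q'.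
Proof.
by move=> /deficientP[qC _ _] /deficientP[q'C _ _] nqq'; rewrite /nonadj qC q'C nqq' negbK.
Qed.

Lemma deficient_no_crossing q q' x x' : q \in D -> q' \in D -> q != q' -> ~~ co q q' ->
  x \in outer co D q -> x' \in outer co D q' -> x = x' /\ #|outer G C x| <= 1.
Proof.
move=> qD q'D nqq' ngqq'; rewrite !in_outer => /andP[xD gqx] /andP[x'D gq'x'].
have [[_ oq _] [_ oq' _]] := (deficientP _ qD, deficientP _ q'D).
have crossing := nonadj_no_crossing (deficient_adj qD q'D nqq' ngqq') gqx gq'x' oq oq'
  (nonadj_notin_deficient gqx xD) (nonadj_notin_deficient gq'x' x'D).
split; first by apply/eqP/negPn/negP => nxx'; apply: crossing; left.
by rewrite leqNgt; apply/negP => gt1; apply: crossing; right.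
Qed.

Lemma exposed_common : {in D, forall q, degree co q <= 1} -> 1 < #|exposed co D| ->
  exists x, [/\ x \in C, x \notin D, #|outer G C x| <= 1 & exposed co D \subset nbr co x].
Proof.
move=> deg1 /card_gt1P [q1 [q2 [q1E q2E nq12]]].
have exposedP q : q \in exposed co D -> q \in D /\ exists x, x \in outer co D q.
  by rewrite inE => /andP[qD /set0Pn].
have [q1D [x xq1]] := exposedP _ q1E.
have [xD gq1x] : x \notin D /\ co q1 x by move: xq1; rewrite in_outer => /andP[].
have common q : q \in exposed co D -> q != q1 -> x \in outer co D q /\ #|outer G C x| <= 1.
  move=> /exposedP [qD [x' x'q]] nqq1.
  have ng : ~~ co q1 q.
    by apply: contraNN xD => gq1q; rewrite -(nbr_unique (deg1 _ q1D) gq1q gq1x).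
  rewrite eq_sym in nqq1.
  by have [xx' ox] := deficient_no_crossing q1D qD nqq1 ng xq1 x'q; rewrite {1}xx'.
exists x; split=> //; first by case/and4P: gq1x.
  by have [] := common q2 q2E; rewrite 1?eq_sym.
apply/subsetP => q qE; rewrite in_nbr sco.1; have [->//|nq] := eqVneq q q1.
by have [] := common q qE nq; rewrite in_outer => /andP[].
Qed.

Lemma sum_nonadj_le6_few_low : (forall c, c \in C -> r <= degree G c + 1) ->
  #|[set c in C | degree G c < r]| <= 5 -> \sum_x degree co x <= 6.
Proof.
move=> deg1 few.
have co1 q : q \in D -> degree co q = 1.
  move=> qD; have [qC _ d0] := deficientP _ qD.
  by have := deficient_degree qD; have := deg1 q qC; move: d0; clear; lia.
have low q : q \in D -> q \in [set c in C | degree G c < r].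
  move=> qD; have [qC _ _] := deficientP _ qD; rewrite inE qC.
  by rewrite -(deficient_degree qD) co1 // addn1 ltnSn.
have sum_le : \sum_x degree co x <= #|D| + #|exposed co D|.
  rewrite (sum_degree_vertex_cover sco deficient_cover) -sum1_card (card_sum_mem (exposed co D)).
  rewrite [X in _ <= _ + X](bigID (mem D)) /= [X in _ <= _ + (_ + X)]big1 ?addn0 => [|q].
    rewrite -big_split /=; apply: leq_sum => q qD; rewrite [q \in exposed co D]inE qD /=.
    have := co1 q qD; rewrite (degree_split co D q) -card_gt0.
    by case: #|outer co D q| => [|[|k]]; clear; lia.
  by move=> qD; rewrite [q \in exposed co D]inE (negbTE qD).
have cD : #|D| <= 5 by apply: leq_trans few; apply/subset_leq_card/subsetP => q; apply: low.
have [|gt1] := leqP #|exposed co D| 1; first by move: sum_le cD; clear; lia.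
have [|x [xC xD ox sub]] := exposed_common _ gt1; first by move=> q /co1->.
have := subset_leq_card sub; rewrite -/(degree co x) => exp_le.
have := degree_nonadj_outer xC; have := deg1 x xC => d1 dE.
have [lt|ge] := ltnP (degree G x) r; last by move: sum_le cD exp_le ox dE ge; clear; lia.
have : #|x |: D| <= 5.
  apply: leq_trans few; apply/subset_leq_card/subsetP => y /setU1P[->|/low //].
  by rewrite inE xC.
by rewrite cardsU1 xD; move: sum_le exp_le ox d1 dE; clear; lia.
Qed.

Definition tight := [set o in U :\: C | (degree G o + 2 == r) && (outer G C o == set0)].

Lemma sum_nonadj_le_tight : (forall o, o \notin C -> degree G o + 2 <= r) ->
  \sum_x degree co x <= 6 + #|tight|.
Proof.
move=> degout; have [[CU _ U5] _ inU _ hvy] := tail.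
have leU : r.+1 <= #|U| by move: U5; clear; lia.
have sum_co : \sum_x degree co x = \sum_(x in C) degree co x.
  rewrite [LHS](bigID (mem C)) /= [X in _ + X]big1 ?addn0 // => x xC.
  by apply: eq_card0 => y; rewrite !inE /nonadj (negbTE xC).
rewrite sum_co; rewrite (sum_degree_split C sym) in hvy.
apply: (heavy_deficit_le r3 leU _ _ hvy).
  rewrite -big_split /= -cC -sum_nat_const; apply: eq_bigr => x xC.
  by have := nonadj_degree irr xC; rewrite cC; clear; lia.
have cUC : #|U :\: C| = #|U| - r.+1 by rewrite cardsD (setIidPr CU) cC.
apply: (@leq_trans (\sum_(x in U :\: C) (2 * r - 5 + (x \in tight)))).
  rewrite big_mkcond [X in _ <= X]big_mkcond /=; apply: leq_sum => x _.
  rewrite in_setC in_setD; have [//|xC] := boolP (x \in C).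
  have [xU|xU] /= := boolP (x \in U); last by rewrite /degree !(nbr_notin inU xU) set0I cards0.
  have := degout x xC; rewrite inE in_setD xC xU /= (degree_split G C x) -cards_eq0.
  by case: #|outer G C x| => [|k]; case: eqP; clear; lia.
rewrite big_split /= sum_nat_const cUC leq_add2l card_sum_mem big_mkcond /=.
by apply: leq_sum => q _; case: (q \in U :\: C).
Qed.

Lemma tightP o : o \in tight -> [/\ o \notin C, D \subset C :\: nbr G o & #|C :\: nbr G o| = 3].
Proof.
rewrite inE => /and3P[/setDP[_ oC] /eqP dgo /eqP oo].
have sub : nbr G o \subset C by rewrite -setD_eq0 -/(outer G C o) oo.
split=> //; last by rewrite cardsD (setIidPr sub) cC -dgo /degree; clear; lia.
apply/subsetP => q /deficientP[qC oq _]; rewrite !inE qC andbT sym.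
by have /setP/(_ o) := oq; rewrite in_outer oC inE => /= ->.
Qed.

Lemma sum_nonadj_le6_sparse_tail : (forall c, c \in C -> r <= degree G c + 2) ->
  (forall o, o \notin C -> degree G o + 2 <= r) -> \sum_x degree co x <= 6.
Proof.
move=> deg2 degout; rewrite leqNgt; apply/negP => gt6.
have tight2 : 1 < #|tight|.
  have := sum_nonadj_le_tight degout; have := sum_degree_even sco; move: gt6; clear.
  by set s := \sum_x _; lia.
have D3 : #|D| <= 3.
  have /card_gt0P [o /tightP[_ sub <-]] := ltnW tight2; exact: subset_leq_card.
suff : \sum_x degree co x <= 6 by rewrite leqNgt gt6.
apply: (sum_degree_small_cover sco deficient_cover D3) => [q qD|q q' x x' qD q'D nqq' ng xq x'q'].
  have [qC _ _] := deficientP _ qD.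
  by have := deficient_degree qD; have := deg2 q qC; clear; lia.
have [xx' ox] := deficient_no_crossing qD q'D nqq' ng xq x'q'.
split=> //; rewrite ltnNge; apply/negP => D3'.
have [xD xC] : x \notin D /\ x \in C.
  by move: xq; rewrite in_outer => /andP[-> /and4P[]].
have sub : tight \subset outer G C x.
  apply/subsetP => o /tightP [oC subD c3]; rewrite in_outer oC sym.
  have DE : D = C :\: nbr G o by apply/eqP; rewrite eqEcard subD c3.
  by move: xD; rewrite DE !inE xC andbT negbK.
by have := subset_leq_card sub; move: tight2 ox; clear; lia.
Qed.

(* Three missing pairs at a common vertex [y] are switched into a path. *)
Lemma K3P3_clique_star_switch y q1 q2 q3 a :
  uniq [:: q1; q2; y; q3] -> nbr co y = [set q1; q2; q3] ->
  (forall u v, co u v -> (u == y) || (v == y)) -> a \in outer G C y -> outer G C q2 = set0 ->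
  exists2 G', rewiring G G' & K3P3_clique G' C.
Proof.
move=> u nbry aty ay oq2; have [aC gya] : a \notin C /\ G y a.
  by move: ay; rewrite in_outer => /andP[].
have co_y q : (co y q) = [|| q == q1, q == q2 | q == q3].
  by rewrite -in_nbr nbry !inE orbA.
have [/and4P[_ q1C ny1 ng1] /and4P[_ q2C ny2 _]] : co y q1 /\ co y q2.
  by rewrite !co_y !eqxx orbT.
have nq21 : q2 != q1 by move: u; rewrite /= !inE !negb_or eq_sym => /andP[/andP[->]].
have g21 : G q2 q1.
  apply/negPn/negP => ng; have /aty : co q2 q1 by rewrite /nonadj q2C q1C nq21.
  by rewrite !(eq_sym _ y) (negbTE ny1) (negbTE ny2).
have nq2a : q2 != a by apply: contraNneq aC => <-.
have ngq2a : ~~ G q2 a by have /setP/(_ a) := oq2; rewrite in_outer inE aC => /= ->.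
have rG := switch_rewiring sG gya g21 ny1 nq2a ng1 ngq2a.
exists (switch G y a q2 q1) => //; apply: (embeds_K3P3_path u) => s t /and4P[sC tC nst].
rewrite /switch negb_or => /andP[npair]; rewrite negb_or /= orbF => /andP[_ ngst].
have [gst|ngst'] := boolP (G s t).
  move: ngst; rewrite gst (@same_pair_notin _ C) /=; [|by right|by []|by []].
  by rewrite negbK same_pair_rev => ->.
have path_edge p : co y p -> ~~ same_pair y q1 y p -> same_pair q2 y y p || same_pair y q3 y p.
  by rewrite co_y /same_pair !eqxx /= => /or3P[]->; rewrite ?orbT.
have gst : co s t by rewrite /nonadj sC tC nst.
case/orP: (aty s t gst) => /eqP yE; rewrite yE in npair gst *.
  by rewrite (path_edge t) ?orbT.
rewrite !(same_pairC _ _ s) in npair *; rewrite sco.1 in gst.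
by rewrite (path_edge s) ?orbT.
Qed.

Lemma K3P3_clique_small_nonadj : (forall c, c \in C -> r <= degree G c + 2) ->
  \sum_x degree co x <= 6 -> exists2 G', rewiring G G' & K3P3_clique G' C.
Proof.
move=> deg2 sum6; have [/forallP small|] := boolP [forall x, degree co x <= 2].
  by exists G; [split | apply: embeds_K3P3_small].
rewrite negb_forall => /existsP [y]; rewrite -ltnNge => gt2.
have sumE := sum_degree_del_vertex y sco.
have [d3 sum0] : degree co y = 3 /\ \sum_x degree (del_vertex co y) x = 0.
  by move: sum6 gt2; rewrite sumE; clear; lia.
have at_y u v : co u v -> (u == y) || (v == y).
  move=> guv; apply/negPn/negP; rewrite negb_or => /andP[nuy nvy].
  have := edges_in_nil sum0 (x := u) (y := v); rewrite /del_vertex guv nuy nvy.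
  by move=> /(_ isT).
have /card_gt2P [q1 [q2 [q3 [[q1y q2y q3y] [n12 n23 n31]]]]] := gt2.
have nbry : nbr co y = [set q1; q2; q3].
  apply/esym/eqP; rewrite eqEcard !subUset !sub1set q1y q2y q3y /= setUC cardsU1 cards2.
  by rewrite !inE negb_or n12 n31 (eq_sym q3) n23 -/(degree co y) d3.
rewrite !in_nbr in q1y q2y q3y; have /and4P[yC _ _ _] := q1y.
have yout : outer G C y != set0.
  by rewrite -card_gt0; have := degree_nonadj_outer yC; have := deg2 y yC; rewrite d3; clear; lia.
have [a ay] := set0Pn _ yout.
apply: (@K3P3_clique_star_switch y q1 q2 q3 a) => //; last exact: nonadj_outer_eq0 q2y yout.
have neq_y q : co y q -> y != q by case/and4P.
by rewrite /= !inE !negb_or n12 n23 (eq_sym q1 q3) n31 (eq_sym _ y) !neq_y // (eq_sym _ y) neq_y.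
Qed.

End Deficit.

(** * The upper bound *)

Lemma sparse_not_heavy r n s : r.+2 <= n -> 3 <= r ->
  s <= r * (r - 1) + (n - r) * (2 * (r - 3)) -> ~ heavy r n s.
Proof.
move=> rn r3; have [e rE] : exists e, r = e + 3 by exists (r - 3); lia.
have [k nE] : exists k, n = k + r.+2 by exists (n - r.+2); lia.
have [rE1 rE3 nrE] : [/\ r - 1 = e + 2, r - 3 = e & n - r = k + 2] by split; lia.
by rewrite /heavy rE1 rE3 nrE nE rE; clear; lia.
Qed.

Lemma few_high_not_heavy r n s h : r.+2 <= n -> h + 5 <= r ->
  s <= h * (h - 1) + (n - h) * (h + (r - 1)) -> ~ heavy r n s.
Proof.
move=> rn hr les; have [e rE] : exists e, r = h + e + 5 by exists (r - h - 5); lia.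
have [k nE] : exists k, n = k + r.+2 by exists (n - r.+2); lia.
have [rE1 nhE] : r - 1 = h + e + 4 /\ n - h = k + e + 7 by lia.
have hh : h * (h - 1) <= h * h by rewrite leq_mul2l leq_subr orbT.
rewrite /heavy nE rE; rewrite rE1 nhE in les; move: les hh; clear.
by case: h => [|h]; [|rewrite subn1 /=]; lia.
Qed.

Section Upper.
Variable V : finType.
Implicit Types (G : rel V) (A C T U : {set V}).

Lemma sum_degree_le G U A k : sgraph G -> supported G U -> A \subset U ->
  {in U :\: A, forall x, #|nbr G x :&: A| + degree G x <= k} ->
  \sum_x degree G x <= #|A| * (#|A| - 1) + (#|U| - #|A|) * k.
Proof.
move=> [sym irr] inU AU le; rewrite (sum_degree_split A sym); apply: leq_add.
  rewrite -sum_nat_const; apply: leq_sum => x xA.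
  by have := card_nbrI_lt irr xA; clear; lia.
have <- : #|U :\: A| = #|U| - #|A| by rewrite cardsD (setIidPr AU).
rewrite -sum_nat_const big_mkcond [X in _ <= X]big_mkcond /=; apply: leq_sum => x _.
rewrite in_setC in_setD; have [//|xA] := boolP (x \in A).
have [xU|xU] /= := boolP (x \in U); first by apply: le; rewrite inE xA.
by rewrite /degree (nbr_notin inU xU) set0I cards0.
Qed.

Section TopSet.
Variables (r : nat) (G : rel V) (U C : {set V}).
Hypotheses (r3 : 3 <= r) (tail : low_tail r G U C).
Hypothesis top : {in C & ~: C, forall c o, degree G o <= degree G c}.

Lemma top_degree_ge c : c \in C -> r <= degree G c + 2.
Proof.
move=> cC; have [[CU cardC U5] sG inU _ hvy] := tail.
rewrite leqNgt; apply/negP => lt; apply: (sparse_not_heavy _ r3 _ hvy).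
  by move: U5; clear; lia.
have cardCc : #|C :\ c| = r by have := cardsD1 c C; rewrite cC cardC => -[].
rewrite -{1 2 3}cardCc; apply: sum_degree_le => //.
  exact: subset_trans (subsetDl _ _) CU.
move=> x; rewrite !inE negb_and negbK => /andP[xc _].
have dx : degree G x <= degree G c by case/orP: xc => [/eqP->//|xC]; apply: top; rewrite ?inE.
by move: dx lt; rewrite (degree_split G (C :\ c) x); clear; lia.
Qed.

Lemma top_card_low : #|[set c in C | degree G c < r]| <= 5.
Proof.
have [[CU cardC U5] sG inU out hvy] := tail.
set N := [set c in C | _]; rewrite leqNgt; apply/negP => N6.
have NC : N \subset C by apply/subsetP => x; rewrite inE => /andP[].
have cN : #|C :\: N| = r.+1 - #|N| by rewrite cardsD (setIidPr NC) cardC.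
have leN : #|N| <= r.+1 by rewrite -cardC subset_leq_card.
apply: (@few_high_not_heavy r #|U| _ #|C :\: N| _ _ _ hvy).
- by move: U5; clear; lia.
- by move: N6 leN; rewrite cN; clear; lia.
apply: sum_degree_le => //; first exact: subset_trans (subsetDl _ _) CU.
move=> x /setDP[_ xCN]; apply: leq_add; first exact/subset_leq_card/subsetIr.
suff : degree G x < r by clear; lia.
move: xCN; rewrite !inE; have [xC|/out //] := boolP (x \in C).
by rewrite andbT negbK.
Qed.

Lemma low_tail_K3P3_clique : exists2 G', rewiring G G' & K3P3_clique G' C.
Proof.
have [_ sG _ _ _] := tail; have [G1 rG1 max1] := exists_inner_maximal C sG.
have tail1 := low_tail_rewiring rG1 tail; have [_ d1] := rG1.
suff sum6 : \sum_x degree (nonadj G1 C) x <= 6.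
  have [|G' rG' g'] := K3P3_clique_small_nonadj tail1 max1 _ sum6.
    by move=> c cC; rewrite d1 top_degree_ge.
  by exists G' => //; apply: rewiring_trans rG'.
have [[c cC lt]|no] := classic (exists2 c, c \in C & degree G c + 1 < r).
  apply: (sum_nonadj_le6_sparse_tail r3 tail1 max1) => [c' c'C|o oC].
    by rewrite d1 top_degree_ge.
  by have := top cC; rewrite d1 => /(_ o); rewrite inE oC => /(_ isT); move: lt; clear; lia.
apply: (sum_nonadj_le6_few_low tail1 max1) => [c cC|].
  by rewrite d1 leqNgt; apply/negP => lt; apply: no; exists c.
by rewrite (_ : [set _ in C | _] = [set c in C | degree G c < r]) ?top_card_low //;
  apply/setP => c; rewrite !inE d1.
Qed.

End TopSet.

Lemma potentially_K3P3_clique_few_high r G U : 3 <= r -> dense r G U ->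
  #|[set x | r <= degree G x]| <= r -> potentially_K3P3_clique G U r.+1.
Proof.
move=> r3 [sG inU U5 _ hvy] few.
have [|C [CU cC top]] := @exists_top_subset V U (degree G) r.+1; first by move: U5; clear; lia.
have top' : {in C & ~: C, forall c o, degree G o <= degree G c}.
  move=> c o cC0; rewrite inE => oC; have [oU|oU] := boolP (o \in U).
    by apply: top; rewrite // inE oC.
  by rewrite (degree_notin inU oU).
have [c cC0 ltc] : exists2 c, c \in C & degree G c < r.
  have : ~~ (C \subset [set x | r <= degree G x]).
    by apply: contraL few => /subset_leq_card; rewrite cC -ltnNge.
  by case/subsetPn => c cC0; rewrite inE -ltnNge => ltc; exists c.
have tail : low_tail r G U C.
  by split=> // y yC; apply: leq_ltn_trans ltc; apply: top'; rewrite ?inE.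
have [G' rG g] := low_tail_K3P3_clique r3 tail top'.
by exists G', C.
Qed.

Lemma K3P3_clique_card3 G C : #|C| = 3 -> K3P3_clique G C.
Proof.
move=> C3; have := enum_uniq (mem C); have := C3; rewrite cardE.
case CE : (enum C) => [|a [|b [|c [|]]]] // _ u; apply: (embeds_K3P3_triangle u) => x y.
have inC z : z \in C -> [|| z == a, z == b | z == c].
  by rewrite -mem_enum CE !inE.
rewrite /nonadj => /and4P[/inC xC /inC yC nxy _] /=; move: xC yC nxy; rewrite /same_pair.
by move=> /or3P[]/eqP-> /or3P[]/eqP->; rewrite !eqxx ?orbT.
Qed.

Lemma dense_potentially_K3P3_clique r G U : 2 <= r -> dense r G U ->
  potentially_K3P3_clique G U r.+1.
Proof.
case: r => [|[|r]] // _; elim: r G U => [|r IH] G U dG.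
  have [sG _ U5 _ _] := dG; have [|C CU cC] := @exists_subset_card V U 3.
    by move: U5; clear; lia.
  by exists G, C; split=> //; apply: K3P3_clique_card3.
have [many|few] := leqP r.+4 #|[set x | r.+3 <= degree G x]|.
  exact: potentially_K3P3_clique_many_high IH dG many.
exact: potentially_K3P3_clique_few_high.
Qed.

Lemma K3P3_clique_contains r G C : 6 <= r -> #|C| = r.+1 -> K3P3_clique G C ->
  exists f : 'I_r.+1 -> V, injective f /\ forall i j, Kr1_minus_K3P3 r i j -> G (f i) (f j).
Proof.
move=> r6 cC [l inj lE].
have [x0 x0C] : exists x, x \in C by apply/card_gt0P; rewrite cC.
pose D := [set i : 'I_r.+1 | [exists x in C, l x == i]].
pose f (i : 'I_r.+1) := odflt x0 [pick x in C | l x == i].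
have fP i : i \in D -> f i \in C /\ l (f i) = i.
  rewrite inE /f => /existsP [x /andP[xC lx]]; case: pickP => [y /andP[yC /eqP //]|/(_ x)].
  by rewrite xC lx.
have [|||g [ginj gC gf]] := @injection_extend _ V D C f.
- by move=> i j /fP[_ li] /fP[_ lj] E; apply: val_inj; rewrite /= -li -lj E.
- by move=> i /fP[].
- by rewrite card_ord cC.
(* A label [< 7] is an index in [D], and there [g] inverts [l]. *)
have lg i : l (g i) < 7 -> l (g i) = i.
  move=> lt7; have ltr : l (g i) < r.+1 by apply: leq_trans lt7 _.
  have kD : Ordinal ltr \in D by rewrite inE; apply/existsP; exists (g i); rewrite gC /=.
  have iE : Ordinal ltr = i by apply: ginj; rewrite gf //; apply: inj; rewrite (fP _ kD).2.
  by rewrite -[in RHS]iE.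
exists g; split=> // i j /andP[nij nK]; apply/negPn/negP => ng; case/negP: nK.
have e : K3P3_edge (l (g i)) (l (g j)) by apply: lE; rewrite /nonadj !gC (inj_eq ginj) nij.
by have [lt7i lt7j] := K3P3_edge_lt7 e; rewrite -(lg i lt7i) -(lg j lt7j).
Qed.

End Upper.

(** * The extremal sequence *)

Lemma realization_sum n (g : rel 'I_n) pi : realization g pi -> sumn pi = \sum_i degree g i.
Proof.
move=> [_ [szpi dE]]; rewrite sumnE (big_nth 0) szpi big_mkord; apply: eq_bigr => i _.
exact/esym/dE.
Qed.

Lemma graphic_even n pi : graphic n pi -> ~~ odd (sumn pi).
Proof.
by move=> [_ [_ [g rg]]]; rewrite (realization_sum rg); apply: sum_degree_even; case: rg.
Qed.

Lemma card_ord_range n a b : b <= n -> #|[set j : 'I_n | a <= j < b]| = b - a.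
Proof.
move=> bn; have lt m : m <= n -> #|[set j : 'I_n | j < m]| = m.
  move=> mn; rewrite -sum1dep_card -(big_ord_widen n (fun=> 1) mn) sum_nat_const card_ord.
  exact: muln1.
have [ab|ba] := leqP a b; last first.
  have -> : b - a = 0 by lia.
  by apply: eq_card0 => j; rewrite !inE; lia.
have -> : [set j : 'I_n | a <= j < b] = [set j : 'I_n | j < b] :\: [set j : 'I_n | j < a].
  by apply/setP => j; rewrite !inE -leqNgt.
rewrite cardsD lt // (setIidPr _) ?lt //; first exact: leq_trans bn.
by apply/subsetP => j; rewrite !inE => /leq_trans; apply.
Qed.

Lemma K3P3_four_vertices a b c d : uniq [:: a; b; c; d] ->
  K3P3_edge a b + K3P3_edge a c + K3P3_edge a d +
  K3P3_edge b c + K3P3_edge b d + K3P3_edge c d <= 3.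
Proof.
pose collapse x := minn x 7; pose apart x y := (x != y) || (x == 7).
have isolated x y : 7 <= y -> K3P3_edge x y = false.
  by move=> y7; apply/negP => /K3P3_edge_lt7 [_]; rewrite ltnNge y7.
have edgeE x y : K3P3_edge x y = K3P3_edge (collapse x) (collapse y).
  rewrite /collapse; have [x7|x7] := ltnP x 7; have [y7|y7] := ltnP y 7 => //.
  - by rewrite !isolated.
  - by rewrite !(K3P3_edgeC _ y) !isolated.
  - by rewrite !isolated.
have collapse_in x : collapse x \in iota 0 8 by rewrite mem_iota /collapse; lia.
have collapse_apart x y : x != y -> apart (collapse x) (collapse y).
  by rewrite /apart /collapse; lia.
have check : all (fun a => all (fun b => all (fun c => all (fun d =>
    [&& apart a b, apart a c, apart a d, apart b c, apart b d & apart c d] ==>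
  (K3P3_edge a b + K3P3_edge a c + K3P3_edge a d +
   K3P3_edge b c + K3P3_edge b d + K3P3_edge c d <= 3))
  (iota 0 8)) (iota 0 8)) (iota 0 8)) (iota 0 8) by vm_compute.
rewrite /= !inE !negb_or => /and4P[/and3P[ab ac ad] /andP[bc bd] cd _].
rewrite (edgeE a b) (edgeE a c) (edgeE a d) (edgeE b c) (edgeE b d) (edgeE c d).
move: check => /allP/(_ _ (collapse_in a))/allP/(_ _ (collapse_in b)).
move=> /allP/(_ _ (collapse_in c))/allP/(_ _ (collapse_in d))/implyP.
by apply; rewrite !collapse_apart.
Qed.

Lemma Kr1_minus_K3P3_four r (T : {set 'I_r.+1}) : #|T| = 4 ->
  6 <= #|arcs (Kr1_minus_K3P3 r) T T|.
Proof.
move=> T4; rewrite card_arcs; under eq_bigr do rewrite card_nbrI_sum.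
rewrite -big_enum; under eq_bigr do rewrite -big_enum.
have := enum_uniq (mem T); have : size (enum T) = 4 by rewrite -cardE.
case: (enum T) => [|a [|b [|c [|d [|]]]]] // _ u.
have := u; rewrite -(map_inj_uniq val_inj) => /K3P3_four_vertices.
move: u; rewrite /= !inE !negb_or => /and4P[/and3P[ab ac ad] /andP[bc bd] cd _].
rewrite !big_cons !big_nil /Kr1_minus_K3P3 !eqxx /= !(eq_sym b a) !(eq_sym c a) !(eq_sym d a).
rewrite !(eq_sym c b) !(eq_sym d b) !(eq_sym d c) ab ac ad bc bd cd /=.
rewrite !(K3P3_edgeC b a) !(K3P3_edgeC c a) !(K3P3_edgeC d a) !(K3P3_edgeC c b).
rewrite !(K3P3_edgeC d b) !(K3P3_edgeC d c).
case: (K3P3_edge a b); case: (K3P3_edge a c); case: (K3P3_edge a d);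
  by case: (K3P3_edge b c); case: (K3P3_edge b d); case: (K3P3_edge c d).
Qed.

(* A star with [c] leaves, centred at [0], and a perfect matching of the remaining vertices. *)
Definition inner_adj (c a b : nat) :=
  [|| (a == 0) && (0 < b <= c), (b == 0) && (0 < a <= c) |
      [&& c < a, c < b & (a - c - 1)./2 == (b - c - 1)./2]].

Lemma inner_adjC c a b : inner_adj c a b = inner_adj c b a.
Proof. by rewrite /inner_adj orbCA (andbCA (c < a)) (eq_sym _./2). Qed.

Lemma inner_adj_center c b : inner_adj c 0 b = (0 < b <= c).
Proof. by rewrite /inner_adj eqxx /= andbF !orbF. Qed.

Lemma inner_adj_leaf c a b : 0 < a <= c -> inner_adj c a b = (b == 0).
Proof.
move=> ac; rewrite /inner_adj ac andbT (ltnNge c); case/andP: ac => a0 ->.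
by rewrite (gtn_eqF a0) orbF.
Qed.

Lemma inner_adj_match c a b : c < a -> b != a ->
  inner_adj c a b = (b == if odd (a - c - 1) then a - 1 else a + 1).
Proof.
move=> ca nba; rewrite /inner_adj ca (leqNgt a) ca !andbF /=.
rewrite (gtn_eqF (leq_ltn_trans (leq0n c) ca)).
have [x aE] : exists x, a = x + c + 1 by exists (a - c - 1); lia.
have -> : a - c - 1 = x by lia.
have [bc|cb] /= := leqP b c; first by case: ifP; lia.
have [y bE] : exists y, b = y + c + 1 by exists (b - c - 1); lia.
have -> : b - c - 1 = y by lia.
have := odd_double_half x; have := odd_double_half y; rewrite aE bE in nba *.
by case: (odd x); case: (odd y) => /= yE xE; apply/eqP/eqP; lia.
Qed.

Section Extremal.
Variables (n k c : nat).

Definition extremal_seq := nseq k (n - 1) ++ (k + c) :: nseq (n - k - 1) (k + 1).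

Definition extremal_graph : rel 'I_n := fun i j =>
  (i != j) && [|| i < k, j < k | inner_adj c (i - k) (j - k)].

Lemma extremal_nth i : nth 0 extremal_seq i =
  if i < k then n - 1 else if i == k then k + c else if i < n then k + 1 else 0.
Proof.
rewrite /extremal_seq nth_cat size_nseq nth_nseq; case: ltnP => // ki.
have [->|nik] := eqVneq i k; first by rewrite subnn.
have -> : i - k = (i - k - 1).+1 by lia.
by rewrite /= nth_nseq; case: ltnP => lt1; case: ltnP => lt2 //; lia.
Qed.

Lemma extremal_sgraph : simple_graph extremal_graph.
Proof.
split=> [i j|i]; rewrite /extremal_graph ?eqxx // eq_sym inner_adjC.
by case: (i < k); case: (j < k).
Qed.

Lemma sumn_extremal_seq : sumn extremal_seq = k * (n - 1) + (k + c) + (n - k - 1) * (k + 1).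
Proof. by rewrite /extremal_seq sumn_cat /= !sumn_nseq; clear; lia. Qed.

Hypotheses (c0 : 0 < c) (nk : k + c < n).

Lemma size_extremal_seq : size extremal_seq = n.
Proof. by rewrite /extremal_seq size_cat /= !size_nseq; lia. Qed.

Lemma extremal_sorted : sorted geq extremal_seq.
Proof.
apply/(sortedP 0) => i; rewrite size_extremal_seq => lt; rewrite /geq /= !extremal_nth.
by do ! case: ifP; lia.
Qed.

Lemma extremal_deg_high (i : 'I_n) : k <= i -> deg extremal_graph i =
  k + #|[set j : 'I_n | [&& k <= j, i != j & inner_adj c (i - k) (j - k)]]|.
Proof.
move=> ki; rewrite /deg -(cardsID [set j : 'I_n | 0 <= j < k]); congr (_ + _).
  rewrite -[RHS](subn0 k) -(@card_ord_range n 0 k); last by lia.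
  congr #|pred_of_set _|; apply/setIidPr/subsetP => j; rewrite !inE /extremal_graph /= => jk.
  by rewrite jk orbT andbT; apply: contraTneq jk => <-; rewrite -leqNgt.
apply: eq_card => j; rewrite !inE /extremal_graph -leqNgt (ltnNge i) ki /= ltnNge.
by case: (k <= j).
Qed.

Lemma inner_nbr_unique (i : 'I_n) : ~~ odd (n - k - 1 - c) -> k < i -> exists p : 'I_n,
  forall j : 'I_n, [&& k <= j, i != j & inner_adj c (i - k) (j - k)] = (j == p).
Proof.
move=> par ki; have [ic|ci] := leqP (i - k) c.
  have kn : k < n by lia.
  exists (Ordinal kn) => j; rewrite inner_adj_leaf ?ic ?subn_gt0 ?ki // -!val_eqE /=.
  by move: ki; clear; lia.
pose p := if odd (i - k - c - 1) then i - 1 else i + 1.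
have pn : p < n by rewrite /p; have := ltn_ord i; move: par ci; clear; case: ifP; lia.
exists (Ordinal pn) => j; have [kj|jk] := leqP k j; last first.
  by rewrite -!val_eqE /= /p; move: ki ci jk; clear; case: ifP; lia.
have [ij|nij] := eqVneq i j.
  by rewrite -ij -!val_eqE /= /p; move: ki; clear; case: ifP; lia.
have njk : j - k != i - k by move: nij; rewrite -!val_eqE /=; move: ki kj; clear; lia.
rewrite inner_adj_match // -!val_eqE /= /p.
by move: kj ki; clear; case: ifP; lia.
Qed.

Lemma extremal_deg i : ~~ odd (n - k - 1 - c) -> deg extremal_graph i = nth 0 extremal_seq i.
Proof.
move=> par; rewrite extremal_nth ltn_ord; case: (ltngtP i k) => ik.
- have -> : deg extremal_graph i = #|[set~ i]|.
    by apply: eq_card => j; rewrite !inE /extremal_graph ik eq_sym andbT.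
  by rewrite cardsC1 card_ord subn1.
- rewrite extremal_deg_high ?(ltnW ik) //; have [p pE] := inner_nbr_unique par ik.
  by congr (_ + _); rewrite -(cards1 p); apply: eq_card => j; rewrite !inE pE.
rewrite extremal_deg_high ik //; congr (_ + _).
transitivity #|[set j : 'I_n | k + 1 <= j < k + c + 1]|; last first.
  by rewrite card_ord_range; lia.
apply: eq_card => j; rewrite !inE subnn inner_adj_center -val_eqE /= ik.
by clear; lia.
Qed.

Lemma extremal_graphic : ~~ odd (n - k - 1 - c) -> graphic n extremal_seq.
Proof.
move=> par; split; first exact: extremal_sorted.
split; first exact: size_extremal_seq.
exists extremal_graph; split; first exact: extremal_sgraph.
by split; [exact: size_extremal_seq | move=> i; apply: extremal_deg].
Qed.

(* The first [k] vertices have full degree, hence are adjacent to all others. *)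
Lemma extremal_outer_deg (g : rel 'I_n) (i : 'I_n) : c <= 2 -> realization g extremal_seq ->
  k <= i -> #|[set j : 'I_n | g i j && (k <= j)]| <= 1 + (i == k :> nat).
Proof.
move=> c2 [[sym irr] [_ dE]] ki.
have full (x j : 'I_n) : x < k -> x != j -> g x j.
  move=> xk nxj; have := dE x; rewrite extremal_nth xk /deg => dx.
  have sub : [set y | g x y] \subset [set~ x].
    by apply/subsetP => y; rewrite !inE; apply: contraTneq => ->; rewrite irr.
  have /setP/(_ j) : [set y | g x y] = [set~ x].
    by apply/eqP; rewrite eqEcard sub cardsC1 card_ord dx; lia.
  by rewrite !inE eq_sym nxj.
have := dE i; rewrite extremal_nth ltn_ord ltnNge ki /= /deg.
rewrite -(cardsID [set j : 'I_n | 0 <= j < k]) (setIidPr _).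
  rewrite card_ord_range; last by lia.
  have -> : [set j | g i j] :\: [set j : 'I_n | 0 <= j < k] = [set j : 'I_n | g i j && (k <= j)].
    by apply/setP => j; rewrite !inE -leqNgt andbC.
  by case: eqVneq => _ /=; move: c2; clear; lia.
apply/subsetP => j; rewrite !inE => jk; rewrite sym; apply: full => //.
by apply: contraTneq jk => ->; rewrite -leqNgt.
Qed.

(* Four vertices of the pattern avoid the first [k] vertices of the graph. *)
Lemma extremal_not_potential : c <= 2 ->
  ~ potentially_graphic (Kr1_minus_K3P3 (k + 3)) n extremal_seq.
Proof.
move=> c2 [g [rg [f [finj fH]]]]; pose H := Kr1_minus_K3P3 (k + 3).
have [T high T4] : exists2 T : {set 'I_(k + 3).+1}, {in T, forall x, k <= f x} & #|T| = 4.
  pose A := [set x : 'I_(k + 3).+1 | k <= f x].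
  have low : #|~: A| <= k.
    rewrite -(card_imset _ finj) -[X in _ <= X](subn0 k) -(@card_ord_range n 0 k); last by lia.
    by apply/subset_leq_card/subsetP => y /imsetP [x]; rewrite !inE -ltnNge => lt ->.
  have [|T /subsetP TA T4] := @exists_subset_card _ A 4.
    by have := cardsC A; rewrite card_ord; lia.
  by exists T => // x /TA; rewrite inE.
have := Kr1_minus_K3P3_four T4; rewrite leqNgt => /negP; apply.
have nbr_le x : x \in T -> #|nbr H x :&: T| <= 1 + (f x == k :> nat).
  move=> xT; apply: leq_trans (extremal_outer_deg c2 rg (high x xT)).
  rewrite -(card_imset _ finj); apply/subset_leq_card/subsetP => z /imsetP [y].
  by rewrite !inE => /andP[hxy yT] ->; rewrite fH // high.
rewrite card_arcs ltnS; apply: (@leq_trans (\sum_(x in T) (1 + (f x == k :> nat)))).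
  exact: leq_sum.
rewrite big_split /= sum1_card T4 leq_add2l.
have [/existsP [x0 /andP[x0T /eqP fx0]]|/existsPn no] :=
    boolP [exists x, (x \in T) && (f x == k :> nat)].
  rewrite (bigD1 x0) //= big1 ?addn0 ?fx0 ?eqxx // => x /andP[xT nx].
  apply/eqP; rewrite eqb0; apply: contraNneq nx => fx.
  by apply/eqP/finj/val_inj; rewrite /= fx0.
by rewrite big1 // => x xT; apply/eqP; rewrite eqb0; have := no x; rewrite xT.
Qed.

End Extremal.

Definition sigma_value r n :=
  if odd (n - r) then (r - 1) * (2 * n - r) - 3 * (n - r) - 1
  else (r - 1) * (2 * n - r) - 3 * (n - r).

Lemma sigma_valueE k n : k + 3 <= n -> 0 < n - (k + 3) ->
  sigma_value (k + 3) n = sumn (extremal_seq n k (~~ odd (n - (k + 3))).+1) + 2.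
Proof.
move=> kn; have [q ->] : exists q, n = q + (k + 3) by exists (n - (k + 3)); lia.
rewrite sumn_extremal_seq /sigma_value addnK => q0.
have -> : k + 3 - 1 = k + 2 by lia.
have -> : 2 * (q + (k + 3)) - (k + 3) = 2 * q + k + 3 by lia.
have -> : q + (k + 3) - 1 = q + k + 2 by lia.
have -> : q + (k + 3) - k - 1 = q + 2 by lia.
have -> : (k + 2) * (2 * q + k + 3) = 3 * q + (2 * k * q + q + (k + 2) * (k + 3)) by lia.
by rewrite addKn; move: q0; clear; case: (odd q) => /=; lia.
Qed.

Lemma heavy_sigma_value k n s : k + 4 <= n -> sigma_value (k + 3) n <= s -> heavy (k + 3) n s.
Proof.
move=> kn; rewrite sigma_valueE; [|lia|lia]; rewrite sumn_extremal_seq /heavy.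
have [q ->] : exists q, n = q + k + 3 by exists (n - k - 3); lia.
have -> : q + k + 3 - 1 = q + k + 2 by lia.
have -> : q + k + 3 - k - 1 = q + 2 by lia.
by clear; lia.
Qed.

Lemma sigma_value_sufficient r n : 6 <= r -> 5 * r + 18 <= n ->
  sigma_prop (Kr1_minus_K3P3 r) n (sigma_value r n).
Proof.
move=> r6 n5 pi [_ [szpi [g rg]]] le_sum; have [sg [_ dE]] := rg.
have [||G [C [[sG d] _ cC gC]]] := @dense_potentially_K3P3_clique 'I_n r g [set: 'I_n].
- by lia.
- split; rewrite ?cardsT ?card_ord //; first by lia.
  rewrite -(realization_sum rg); have rE : r - 3 + 3 = r by lia.
  by rewrite -rE; apply: heavy_sigma_value; rewrite ?rE //; lia.
have [f [finj fH]] := K3P3_clique_contains r6 cC gC.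
exists G; split; last by exists f.
by split=> //; split=> // i; rewrite -dE; apply: d.
Qed.

Lemma exists_extremal_sequence r n : 3 <= r -> r < n -> exists pi,
  [/\ graphic n pi, sigma_value r n = sumn pi + 2 &
      ~ potentially_graphic (Kr1_minus_K3P3 r) n pi].
Proof.
move=> r3 rn; have -> : r = (r - 3) + 3 by lia.
set k := r - 3; have kn : k + 3 < n by rewrite /k; lia.
pose c := (~~ odd (n - (k + 3))).+1; have c2 : c <= 2 by rewrite /c; case: (odd _).
have par : ~~ odd (n - k - 1 - c).
  rewrite /c; have [q ->] : exists q, n = q + (k + 3) by exists (n - (k + 3)); lia.
  by rewrite addnK; case oq : (odd q) => /=; lia.
exists (extremal_seq n k c); split.
- by apply: extremal_graphic => //; lia.
- by apply: sigma_valueE; lia.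
by apply: extremal_not_potential; lia.
Qed.

Theorem theorem1p1 (r n : nat) :
  6 <= r -> 5 * r + 18 <= n ->
  is_sigma (Kr1_minus_K3P3 r) n
    (if odd (n - r)
     then (r - 1) * (2 * n - r) - 3 * (n - r) - 1
     else (r - 1) * (2 * n - r) - 3 * (n - r)).
Proof.
move=> r6 n5; rewrite -/(sigma_value r n).
have [||pi [gr valE not_pot]] := @exists_extremal_sequence r n; [lia | lia |].
have ev := graphic_even gr.
split; first by rewrite valE addn2 /= negbK.
split; first exact: sigma_value_sufficient.
move=> l evl suff_l; rewrite leqNgt; apply/negP => lt; apply/not_pot/suff_l => //.
by move: lt evl ev; rewrite valE /seq_sum; clear; lia.
Qed.
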